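(* For every positive integer $n$ there exist matroids $M'$ and $N'$, neither of which has a coloop, such that: both are positroids; both are transversal matroids; $M'$ and $N'$ have the same configuration; and $bw(N')-bw(M')\geq n$.
   Context: For a matroid $M$ with rank function $r$ and $X\subseteq E(M)$, write $\overline{X}=E(M)-X$ and $\lambda_M(X)=r(X)+r(\overline{X})-r(M)$. A branch-decomposition of $M$ is a tree $T$ in which every non-leaf vertex has degree $3$, together with an injection $\phi$ from $E(M)$ to the set of leaves of $T$. Each edge $e$ of $T$ displays the partition $(X,\overline{X})$ of $E(M)$ given by the labels on the leaves of the two components of $T-e$; its width is $\lambda_M(X)+1$. The width of the branch-decomposition is the maximum width of its edges, and the branch-width $bw(M)$ is the minimum width over all branch-decompositions of $M$. A cyclic flat of $M$ is a flat $F$ such that $M|F$ has no coloops; the cyclic flats form a lattice $\mathcal{Z}(M)$ under inclusion. The configuration of $M$ is the abstract lattice $\mathcal{Z}(M)$ together with the size and rank of the cyclic flat at each lattice element; two matroids have the same configuration if there is a lattice isomorphism between their lattices of cyclic flats preserving sizes and ranks. A positroid is a matroid of rank $r$ on $m$ elements represented over $\mathbb{R}$ by an $r\times m$ matrix all of whose $r\times r$ maximal minors are nonnegative. A matroid is transversal if it is a matroid union of rank-$1$ matroids. *)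

(* Defs.v *)
From HB Require Import structures.
From mathcomp Require Import all_boot all_order all_algebra.
From mathcomp Require Import boolp reals zify.
Set Implicit Arguments.
Unset Strict Implicit.
Unset Printing Implicit Defensive.
Import Order.TTheory GRing.Theory Num.Theory.

Record matroid (E : finType) := Matroid {
  indep : {set {set E}};
  indep0 : set0 \in indep;
  indepS : forall I J : {set E}, J \in indep -> I \subset J -> I \in indep;
  indep_aug : forall I J : {set E}, I \in indep -> J \in indep -> #|I| < #|J| ->
    exists2 x, x \in J :\: I & x |: I \in indep
}.

Section MatroidNotions.
Variables (E : finType) (M : matroid E).

Definition rk (X : {set E}) : nat := \max_(I in indep M | I \subset X) #|I|.

Definition mrank : nat := rk [set: E].

Definition lambda (X : {set E}) : nat := rk X + rk (~: X) - mrank.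

(* The bases of the restriction M|X. *)
Definition basis_of (X B : {set E}) : bool :=
  maxset (fun I : {set E} => (I \in indep M) && (I \subset X)) B.

(* x is a coloop of the restriction M|X: it lies in every basis of M|X. *)
Definition coloop_in (X : {set E}) (x : E) : bool :=
  (x \in X) && [forall B : {set E}, basis_of X B ==> (x \in B)].

Definition coloop_free : Prop := forall x : E, ~~ coloop_in [set: E] x.

Definition flat (F : {set E}) : bool :=
  [forall x, (x \notin F) ==> (rk F < rk (x |: F))].

Definition cyclic_flat (F : {set E}) : bool :=
  flat F && [forall x, ~~ coloop_in F x].

Definition cyclic_flats : {set {set E}} := [set F | cyclic_flat F].

End MatroidNotions.

(* An isomorphism of the lattices of cyclic flats, both ordered by inclusion,
   that preserves sizes and ranks. *)
Definition same_configuration (S T : finType) (M : matroid S) (N : matroid T) :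
    Prop :=
  exists f : {set S} -> {set T},
    [/\ {in cyclic_flats M &, injective f},
        f @: cyclic_flats M = cyclic_flats N,
        {in cyclic_flats M &, {mono f : F G / F \subset G}},
        {in cyclic_flats M, forall F, #|f F| = #|F|} &
        {in cyclic_flats M, forall F, rk N (f F) = rk M F}].

Definition is_matroid_union (E : finType) (M : matroid E) (k : nat)
    (Ms : 'I_k -> matroid E) : Prop :=
  forall I : {set E}, I \in indep M <->
    exists2 J : 'I_k -> {set E},
      (forall i, J i \in indep (Ms i)) & I = \bigcup_(i < k) J i.

Definition transversal_matroid (E : finType) (M : matroid E) : Prop :=
  exists (k : nat) (Ms : 'I_k -> matroid E),
    (forall i, mrank (Ms i) = 1) /\ is_matroid_union M Ms.

(* The matrix columns are indexed by the positions of the elements of E in some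
   linear order of E, given by the bijection s. *)
Definition positroid (R : realType) (E : finType) (M : matroid E) : Prop :=
  exists (s : 'I_#|E| -> E) (A : 'M[R]_(mrank M, #|E|)),
    [/\ bijective s,
        (forall X : {set 'I_#|E|},
           (s @: X \in indep M) = free [seq col j A | j <- enum X]) &
        (forall f : 'I_(mrank M) -> 'I_#|E|,
           {homo f : i j / (i < j)%N} -> (0 <= \det (colsub f A))%R)].

Section Trees.
Variables (V : finType) (e : rel V).

Definition degree (v : V) : nat := #|[set w | e v w]|.

Definition is_leaf (v : V) : bool := degree v == 1.

(* A single edge {x, y} is traversed by the closed walk [:: x; y], so only the
   cycles with at least three vertices are graph cycles. *)
Definition is_tree : Prop :=
  [/\ 0 < #|V|, symmetric e, irreflexive e,
      (forall x y, connect e x y) &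
      (forall c : seq V, ucycle e c -> size c <= 2)].

Definition del_edge (u v : V) : rel V :=
  [rel x y | [&& e x y, (x, y) != (u, v) & (x, y) != (v, u)]].

End Trees.

Record branch_decomposition (E : finType) := BranchDecomposition {
  bd_vertex : finType;
  bd_edge : rel bd_vertex;
  bd_label : E -> bd_vertex;
  bd_tree : is_tree bd_edge;
  bd_cubic : forall v, ~~ is_leaf bd_edge v -> degree bd_edge v = 3;
  bd_label_inj : injective bd_label;
  bd_label_leaf : forall x, is_leaf bd_edge (bd_label x)
}.

(* The labels in the component of u in T - uv. *)
Definition displayed (E : finType) (D : branch_decomposition E)
    (u v : bd_vertex D) : {set E} :=
  [set x | connect (del_edge (@bd_edge E D) u v) u (bd_label D x)].

Definition bd_width (E : finType) (M : matroid E) (D : branch_decomposition E) :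
    nat :=
  \max_(p : bd_vertex D * bd_vertex D | bd_edge p.1 p.2)
    (lambda M (displayed p.1 p.2) + 1).

(* Every finite set labels leaves of a large enough caterpillar, with spine
   1, 3, 5, ... *)
Section Caterpillar.
Variable m : nat.

Definition cat_parent (i : nat) : nat :=
  if i <= 1 then 0 else if odd i then i - 2 else i - 1.

Definition cat_edge : rel 'I_(m.*2.+2) :=
  [rel x y : 'I_(m.*2.+2) |
     ((0 < x) && (cat_parent x == y)) || ((0 < y) && (cat_parent y == x))].

Lemma cat_parent_lt i : 0 < i -> cat_parent i < i.
Proof. by rewrite /cat_parent; case: ifP => ?; [lia|case: ifP => ?; lia]. Qed.

Lemma cat_edge_sym : symmetric cat_edge.
Proof. by move=> x y; rewrite /cat_edge /= orbC. Qed.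

Lemma cat_edge_lt (x y : 'I_(m.*2.+2)) :
  cat_edge x y -> y <= x -> cat_parent x = y.
Proof.
move=> /orP[/andP[_ /eqP//]|/andP[y0 /eqP xy]] yx.
by have := cat_parent_lt y0; lia.
Qed.

Lemma cat_tree : is_tree cat_edge.
Proof.
split.
- by rewrite card_ord.
- exact: cat_edge_sym.
- move=> x; rewrite /cat_edge /= orbb; apply/negP => /andP[x0 /eqP xx].
  by have := cat_parent_lt x0; lia.
- have c0 (x : 'I_(m.*2.+2)) : connect cat_edge x ord0.
    have [k] := ubnP (x : nat); elim: k x => // k IH x xk.
    have [x0|x0] := posnP x.
      by rewrite (_ : x = ord0) ?connect0 //; apply: val_inj.
    have px := cat_parent_lt x0.
    have pm : cat_parent x < m.*2.+2 by have := ltn_ord x; lia.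
    apply: (@connect_trans _ _ (Ordinal pm)); last by apply: IH => /=; lia.
    by apply: connect1; rewrite /cat_edge /= x0 eqxx.
  move=> x y; apply: connect_trans (c0 x) _.
  by rewrite (sym_connect_sym cat_edge_sym).
- move=> c /andP[cc uc]; rewrite leqNgt; apply/negP => c3.
  have [x0 x0c] : exists x, x \in c by case: c {cc uc} c3 => // a c; exists a; rewrite inE eqxx.
  pose x := [arg max_(i > x0 in c) (i : nat)].
  have [xc xmax] : x \in c /\ forall y, y \in c -> y <= x.
    by rewrite /x; case: arg_maxnP => // i ic im; split => // y /im.
  have nx := next_cycle cc xc.
  have px : cat_edge x (prev c x) by rewrite cat_edge_sym; exact: prev_cycle.
  have en := cat_edge_lt nx (xmax _ (etrans (mem_next c x) xc)).
  have ep := cat_edge_lt px (xmax _ (etrans (mem_prev c x) xc)).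
  have np : next c x = prev c x by apply: val_inj; rewrite /= -en -ep.
  have [i s ri] := rot_to xc.
  have nn : next (x :: s) (next (x :: s) x) = x.
    by rewrite -ri !next_rot // np next_prev.
  have us : uniq (x :: s) by rewrite -ri rot_uniq.
  have ss : 2 < size (x :: s) by rewrite -ri size_rot.
  case: s nn us ss {ri} => [//|a [//|b s]] /=.
  rewrite eqxx !inE; have [->//|_] := eqVneq x a.
  by rewrite eqxx => ->; rewrite eqxx.
Qed.

Lemma cat_leaf (v : 'I_(m.*2.+2)) : ~~ odd v -> is_leaf cat_edge v.
Proof.
move=> ev; rewrite /is_leaf /degree; apply/cards1P.
have wm : (if v == 0 :> nat then 1 else v.-1) < m.*2.+2.
  by have := ltn_ord v; case: ifP => _; lia.
exists (Ordinal wm); apply/setP => w; rewrite !inE -val_eqE /cat_edge /= /cat_parent.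
by apply/idP/idP; repeat case: ifP; lia.
Qed.

Lemma cat_cubic (v : 'I_(m.*2.+2)) :
  ~~ is_leaf cat_edge v -> degree cat_edge v = 3.
Proof.
have [ov|ev /negP[]] := boolP (odd v); last exact: cat_leaf.
have [vm|vm] := leqP v.+2 m.*2.+1.
  move=> _; rewrite /degree.
  have pm : cat_parent v < m.*2.+2.
    by have := ltn_ord v; rewrite /cat_parent; repeat case: ifP; lia.
  have am : v.+1 < m.*2.+2 by lia.
  have bm : v.+2 < m.*2.+2 by lia.
  rewrite (_ : [set w | _] = [set Ordinal pm; Ordinal am; Ordinal bm]).
    have pv : cat_parent v < v by apply: cat_parent_lt; lia.
    rewrite setUC cardsU1 cards2 !inE -!val_eqE /=.
    have -> : v.+2 == cat_parent v = false by lia.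
    have -> : v.+2 == v.+1 = false by lia.
    by have -> : cat_parent v == v.+1 = false by lia.
  apply/setP => w; rewrite !inE -!val_eqE /cat_edge /= /cat_parent.
  by apply/idP/idP; repeat case: ifP; lia.
case/negP; rewrite /is_leaf /degree; apply/cards1P.
have pm : cat_parent v < m.*2.+2.
  by have := ltn_ord v; rewrite /cat_parent; repeat case: ifP; lia.
exists (Ordinal pm); apply/setP => w; rewrite !inE -val_eqE /cat_edge /=.
have := ltn_ord w; have := ltn_ord v; rewrite /cat_parent.
by move=> ? ?; apply/idP/idP; repeat case: ifP; lia.
Qed.

End Caterpillar.

Lemma branch_decomposition_exists (E : finType) :
  exists D : branch_decomposition E, True.
Proof.
have lm (x : E) : (enum_rank x).*2 < #|E|.*2.+2.
  by rewrite -doubleS ltn_double ltnS ltnW.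
have inj : injective (fun x => Ordinal (lm x)).
  by move=> x y [] /double_inj /val_inj /enum_rank_inj.
have leaf x : is_leaf (@cat_edge #|E|) (Ordinal (lm x)).
  by apply: cat_leaf; rewrite /= odd_double.
by exists (BranchDecomposition (cat_tree _) (@cat_cubic _) inj leaf).
Qed.

Lemma bd_width_exists (E : finType) (M : matroid E) :
  exists k, `[< exists D : branch_decomposition E, bd_width M D = k >].
Proof.
have [D _] := branch_decomposition_exists E.
by exists (bd_width M D); apply/asboolP; exists D.
Qed.

Definition bw (E : finType) (M : matroid E) : nat := ex_minn (bd_width_exists M).

(* Main.v *)
Require Import Defs.
From mathcomp Require Import all_boot all_order all_fingroup all_algebra.
From mathcomp Require Import boolp reals zify.

Set Implicit Arguments.
Unset Strict Implicit.
Unset Printing Implicit Defensive.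
Import Order.TTheory GRing.Theory Num.Theory.

(** For sets [A] and [B] with [#|A :&: B| + r <= 2 a], the sets meeting [A] and [B]
    in at most [a] elements each, and having at most [r] elements, are the
    independent sets of a matroid. When [A] and [B] are large enough its cyclic
    flats are [set0], [A], [B] and the ground set, so the configuration does not
    see how much [A] and [B] overlap. On [18 n] elements take [a = 4 n], [r = 5 n],
    and intervals [A], [B] of length [7 n].

    If [A] and [B] are disjoint, a tree with three arms carrying [A], [B] and the
    remaining [4 n] elements has width at most [4 n + 1], as each arm has rank at
    most [4 n]. If they overlap in [3 n] elements, no three non-spanning sets cover
    the ground set, and hence some edge of every branch-decomposition separates
    two spanning sets, which gives branch-width [5 n + 1].

    In both cases the matroid is the truncation of a direct sum of a
    staircase-shaped transversal matroid on [A :|: B] and a free matroid. The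
    direct sum is represented by a totally nonnegative staircase matrix, and
    multiplication by a Vandermonde matrix with [5 n] rows truncates it; by the
    Cauchy-Binet formula all maximal minors stay nonnegative. *)

(** * Rank, coloops, and matroids cut out by two cardinality bounds *)

Section RankFunction.
Variables (E : finType) (M : matroid E).
Implicit Types (X Y I B : {set E}) (x : E).

Lemma rk_indep X I : I \in indep M -> I \subset X -> #|I| <= rk M X.
Proof. by move=> iI IX; apply: leq_bigmax_cond; apply/andP. Qed.

Lemma rk_witness X : exists I, [/\ I \in indep M, I \subset X & #|I| = rk M X].
Proof.
have [|I /andP[iI IX] eI] :=
  @eq_bigmax_cond _ [pred I : {set E} | (I \in indep M) && (I \subset X)] (fun I => #|I|).
  by apply/card_gt0P; exists set0; rewrite inE indep0 sub0set.
by exists I; split=> //; rewrite -eI.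
Qed.

Lemma rkS X Y : X \subset Y -> rk M X <= rk M Y.
Proof.
move=> XY; have [I [iI IX <-]] := rk_witness X.
by apply: rk_indep => //; apply: subset_trans XY.
Qed.

Lemma rk_le_card X : rk M X <= #|X|.
Proof. by have [I [_ IX <-]] := rk_witness X; exact: subset_leq_card. Qed.

Lemma basis_card X B : Defs.basis_of M X B -> #|B| = rk M X.
Proof.
case/maxsetP=> /andP[iB BX] maxB; apply/eqP; rewrite eqn_leq rk_indep //=.
rewrite leqNgt; apply/negP; have [I [iI IX <-]] := rk_witness X.
case/(indep_aug iB iI) => x; rewrite inE => /andP[xB xI] ixB.
have /maxB e : (x |: B \in indep M) && (x |: B \subset X).
  by rewrite ixB subUset BX sub1set (subsetP IX).
by move: xB; rewrite -(e (subsetUr _ _)) setU11.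
Qed.

Lemma card_basis X I :
  I \in indep M -> I \subset X -> rk M X <= #|I| -> Defs.basis_of M X I.
Proof.
move=> iI IX hI; apply/maxsetP; split=> [|J /andP[iJ JX] IJ]; first by rewrite iI.
by apply/esym/eqP; rewrite eqEcard IJ (leq_trans _ hI) // rk_indep.
Qed.

Lemma coloop_inE X x : coloop_in M X x = (x \in X) && (rk M (X :\ x) < rk M X).
Proof.
rewrite /coloop_in; congr (_ && _); apply/forallP/idP => [h|h B].
  rewrite ltnNge; apply/negP => le; have [I [iI IX eI]] := rk_witness (X :\ x).
  have bI : Defs.basis_of M X I.
    by apply: card_basis; rewrite // ?eI // (subset_trans IX) ?subD1set.
  by have /implyP/(_ bI)/(subsetP IX) := h I; rewrite !inE eqxx.
apply/implyP=> bB; apply/negPn/negP => xB; move: h; rewrite ltnNge => /negP[].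
rewrite -(basis_card bB); case/maxsetP: bB => /andP[iB BX] _.
by apply: rk_indep => //; rewrite subsetD1 BX.
Qed.

Lemma lambda_le_rk X : lambda M X <= rk M X.
Proof. by rewrite /lambda leq_subLR addnC leq_add2r rkS. Qed.

Lemma lambdaC X : lambda M (~: X) = lambda M X.
Proof. by rewrite /lambda setCK addnC. Qed.

End RankFunction.

Section TwoBounds.
Variables (E : finType) (a r : nat) (A B : {set E}).
Hypothesis AB_small : #|A :&: B| + r <= a + a.

Definition two_bound_sets : {set {set E}} :=
  [set I : {set E} | [&& #|I| <= r, #|I :&: A| <= a & #|I :&: B| <= a]].

Lemma two_boundP (I : {set E}) :
  reflect [/\ #|I| <= r, #|I :&: A| <= a & #|I :&: B| <= a] (I \in two_bound_sets).
Proof. by rewrite inE; apply: and3P. Qed.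

Lemma two_bound0 : set0 \in two_bound_sets.
Proof. by rewrite inE !set0I !cards0. Qed.

Lemma two_boundS (I J : {set E}) :
  J \in two_bound_sets -> I \subset J -> I \in two_bound_sets.
Proof.
move=> /two_boundP[h1 h2 h3] IJ; apply/two_boundP; split.
- exact: leq_trans (subset_leq_card IJ) h1.
- by apply: leq_trans h2; apply: subset_leq_card; apply: setSI.
- by apply: leq_trans h3; apply: subset_leq_card; apply: setSI.
Qed.

(** Inclusion-exclusion: [I] has at least [2a - #|A :&: B|] elements, and [AB_small] makes this at
    least [r]. So below size [r] at most one of the bounds on [A] and [B] can block an
    augmentation. *)
Lemma two_bound_tight (I : {set E}) :
  a <= #|I :&: A| -> a <= #|I :&: B| -> r <= #|I|.
Proof.
move=> hA hB; have := cardsUI (I :&: A) (I :&: B); rewrite -setIUr setIACA setIid.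
have := subset_leq_card (subsetIl I (A :|: B)).
have := subset_leq_card (subsetIr I (A :&: B)).
by lia.
Qed.

Lemma two_bound_add (I : {set E}) x :
  I \in two_bound_sets -> #|I| < r -> x \notin I ->
  (x \in A -> #|I :&: A| < a) -> (x \in B -> #|I :&: B| < a) ->
  x |: I \in two_bound_sets.
Proof.
move=> /two_boundP[h1 h2 h3] h xI hA hB; apply/two_boundP.
have hU (S : {set E}) : #|I :&: S| <= a -> (x \in S -> #|I :&: S| < a) ->
    #|(x |: I) :&: S| <= a.
  move=> hS; rewrite setIUl; have [xS hx|xS _] := boolP (x \in S).
    by rewrite (setIidPl _) ?sub1set // cardsU1; case: (_ \in _) => /=; [|have := hx isT]; lia.
  by rewrite (_ : [set x] :&: S = set0) ?set0U //; apply/eqP; rewrite setI_eq0 disjoints1.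
by rewrite cardsU1 xI; split; [lia | apply: hU | apply: hU].
Qed.

Lemma two_bound_aug (I J : {set E}) :
  I \in two_bound_sets -> J \in two_bound_sets -> #|I| < #|J| ->
  exists2 x, x \in J :\: I & x |: I \in two_bound_sets.
Proof.
move=> iI /two_boundP[j1 j2 j3] IJ; have Ir : #|I| < r by lia.
have pick (S : {set E}) : #|I :\: S| < #|J :\: S| ->
    exists2 x, x \in J :\: I & x \notin S.
  move=> lt; case: (boolP (J :\: S \subset I :\: S)) => [/subset_leq_card|/subsetPn[x]].
    by lia.
  by rewrite !inE => /andP[xS xJ]; rewrite xS /= => xI; exists x; rewrite ?inE ?xI.
have [_ i2 i3] := two_boundP _ iI.
have := cardsID A I; have := cardsID B I; have := cardsID A J; have := cardsID B J.
move=> JB JA IB IA.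
(* If the bound on [A] is tight for [I], then [J] has more elements than [I] outside [A], and adding
   one of those cannot violate it; [B] is symmetric. *)
have [IAa|IAa] := leqP a #|I :&: A|.
  have [IBa|IBa] := leqP a #|I :&: B|; first by have := two_bound_tight IAa IBa; lia.
  have [|x xJI xA] := pick A; first by lia.
  by exists x => //; apply: two_bound_add => //; [case/setDP: xJI|rewrite (negPf xA)].
have [IBa|IBa] := leqP a #|I :&: B|.
  have [|x xJI xB] := pick B; first by lia.
  by exists x => //; apply: two_bound_add => //; [case/setDP: xJI|rewrite (negPf xB)].
have [|x xJI _] := pick set0; first by rewrite !setD0.
by exists x => //; apply: two_bound_add => //; case/setDP: xJI.
Qed.

Definition two_bound : matroid E :=
  Matroid two_bound0 two_boundS two_bound_aug.

Let M := two_bound.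

(** A largest independent [I] inside [X] cannot be extended in [X]. So [#|I|] is [r], or the bound
    on [A] is tight and [I] exhausts [X :\: A], or likewise for [B], or [I] is all of [X]; each case
    attains one term of the minimum. *)
Lemma rk_two_bound X : rk M X =
  minn (minn #|X| r) (minn (a + #|X :\: A|) (a + #|X :\: B|)).
Proof.
apply/eqP; rewrite eqn_leq; apply/andP; split.
  have [I [/two_boundP[h1 h2 h3] IX <-]] := rk_witness M X.
  have := subset_leq_card IX; have := subset_leq_card (setSD A IX).
  have := subset_leq_card (setSD B IX); have := cardsID A I; have := cardsID B I.
  by lia.
have [I [iI IX eI]] := rk_witness M X; rewrite -eI.
have [rI|Ir] := leqP r #|I|; first by lia.
have full x : x \in X -> x \notin I -> x |: I \notin two_bound_sets.
  move=> xX xI; apply/negP => i'.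
  have : x |: I \subset X by rewrite subUset sub1set xX.
  by move/(@rk_indep _ M X _ i'); rewrite -eI cardsU1 xI; lia.
have sub (S : {set E}) : (forall x, x \in X -> x \notin S -> x \in I) -> #|X :\: S| <= #|I :\: S|.
  move=> h; apply/subset_leq_card/subsetP=> x; rewrite !inE => /andP[xS xX].
  by rewrite xS h.
have := cardsID A I; have := cardsID B I; move=> IB IA.
have [IAa|IAa] := leqP a #|I :&: A|.
  have [IBa|IBa] := leqP a #|I :&: B|; first by have := two_bound_tight IAa IBa; lia.
  suff /sub : forall x, x \in X -> x \notin A -> x \in I by lia.
  move=> x xX xA; apply/negPn/negP => xI; case/negP: (full x xX xI).
  by apply: two_bound_add => //; rewrite (negPf xA).
have [IBa|IBa] := leqP a #|I :&: B|.
  suff /sub : forall x, x \in X -> x \notin B -> x \in I by lia.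
  move=> x xX xB; apply/negPn/negP => xI; case/negP: (full x xX xI).
  by apply: two_bound_add => //; rewrite (negPf xB).
suff /sub : forall x, x \in X -> x \notin set0 -> x \in I by rewrite !setD0; lia.
move=> x xX _; apply/negPn/negP => xI; case/negP: (full x xX xI).
exact: two_bound_add.
Qed.

Lemma two_bound_AB : a < r -> a < #|A| -> ~~ (A \subset B).
Proof.
move=> ar aA; rewrite -setD_eq0 -cards_eq0 -lt0n.
by have := cardsID B A; lia.
Qed.

Lemma two_bound_BA : a < r -> a < #|B| -> ~~ (B \subset A).
Proof.
move=> ar aB; rewrite -setD_eq0 -cards_eq0 -lt0n.
by have := cardsID A B; rewrite setIC; lia.
Qed.

Hypotheses (a_gt0 : 0 < a) (a_lt_r : a < r) (aA : a < #|A|) (aB : a < #|B|).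
Hypotheses (rA : r < a + #|~: A|) (rB : r < a + #|~: B|).

Lemma mrank_two_bound : mrank M = r.
Proof.
rewrite /mrank rk_two_bound !setTD cardsT.
by have := max_card (mem A); have := cardsC A; lia.
Qed.

(** The strict inequalities [rA] and [rB] leave one element to spare outside [A] and outside [B]. *)
Lemma rk_two_boundT x : rk M ([set: E] :\ x) = r.
Proof.
rewrite rk_two_bound !setTD.
have hD (S : {set E}) : #|~: S| <= #|~: [set x] :\: S|.+1.
  by rewrite setDE setIC -setDE; have := cardsD1 x (~: S); case: (_ \in _); lia.
have := hD A; have := hD B; have := cardsC1 x; have := cardsC A.
by move=> *; lia.
Qed.

Lemma two_bound_coloop_free : coloop_free M.
Proof. by move=> x; rewrite coloop_inE rk_two_boundT -mrank_two_bound ltnn andbF. Qed.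

Let A_notin_B : 0 < #|A :\: B|.
Proof. by rewrite lt0n cards_eq0 setD_eq0 two_bound_AB. Qed.
Let B_notin_A : 0 < #|B :\: A|.
Proof. by rewrite lt0n cards_eq0 setD_eq0 two_bound_BA. Qed.

Lemma rk_two_boundA : rk M A = a.
Proof. by rewrite rk_two_bound setDv cards0; lia. Qed.

Lemma rk_two_boundB : rk M B = a.
Proof. by rewrite rk_two_bound setDv cards0; lia. Qed.

(** The term of the rank formula attained at [F] decides which set [F] is. An independent cyclic set
    is empty and a spanning flat is everything. If the rank is [a + #|F :\: A|], elements of [F]
    outside [A] would be coloops and elements of [A] can be added without raising the rank, so
    [F = A]; likewise for [B]. *)
Lemma two_bound_cyclic_flats :
  cyclic_flats M = [set set0; A; B; [set: E]].
Proof.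
apply/setP=> F; rewrite !inE /cyclic_flat /flat; apply/idP/idP; last first.
  have noc (G : {set E}) : (forall x, x \in G -> rk M G <= rk M (G :\ x)) ->
      [forall x, ~~ coloop_in M G x].
    move=> h; apply/forallP => x; rewrite coloop_inE; apply/negP=> /andP[xG].
    by have := h x xG; lia.
  have dD (S : {set E}) x : #|S| <= #|S :\ x|.+1.
    by have := cardsD1 x S; case: (x \in S); lia.
  case/orP=> [/orP[/orP[]|]|] /eqP->.
  - apply/andP; split; last by apply: noc => x; rewrite inE.
    apply/forallP=> x; apply/implyP => _; rewrite setU0.
    rewrite [X in _ < X]rk_two_bound cards1.
    by apply: leq_ltn_trans (rk_le_card M set0) _; rewrite cards0; lia.
  - apply/andP; split; last first.
      apply: noc => x xA; rewrite rk_two_boundA rk_two_bound.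
      by have := dD A x; lia.
    apply/forallP=> x; apply/implyP => xA; rewrite rk_two_boundA rk_two_bound.
    rewrite cardsU1 xA setDUl setDv setU0 setDUl.
    have -> : [set x] :\: A = [set x] by apply/setDidPl; rewrite disjoints1.
    by have := subset_leq_card (subsetUr ([set x] :\: B) (A :\: B)); rewrite cards1; lia.
  - apply/andP; split; last first.
      apply: noc => x xB; rewrite rk_two_boundB rk_two_bound.
      by have := dD B x; lia.
    apply/forallP=> x; apply/implyP => xB; rewrite rk_two_boundB rk_two_bound.
    rewrite cardsU1 xB !setDUl setDv setU0.
    have -> : [set x] :\: B = [set x] by apply/setDidPl; rewrite disjoints1.
    by have := subset_leq_card (subsetUr ([set x] :\: A) (B :\: A)); rewrite cards1; lia.
  - apply/andP; split; first by apply/forallP=> x; rewrite inE.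
    by apply: noc => x _; rewrite rk_two_boundT -/(mrank M) mrank_two_bound.
case/andP=> /forallP flF /forallP cyF.
have noc x : x \in F -> rk M F <= rk M (F :\ x).
  by move=> xF; have := cyF x; rewrite coloop_inE xF -leqNgt.
have fl x : x \notin F -> rk M F < rk M (x |: F) by move=> h; exact: (implyP (flF x)).
have sub (S : {set E}) : rk M F = a + #|F :\: S| ->
    (forall X, rk M X <= a + #|X :\: S|) -> F == S.
  move=> eF le.
  have FS : F \subset S.
    apply/subsetP => x xF; apply/negPn/negP => xS.
    have := noc x xF; have := le (F :\ x).
    have := cardsD1 x (F :\: S); rewrite !inE xF xS setDDl setUC -setDDl /=.
    by lia.
  rewrite eqEsubset FS; apply/subsetP => x xS; apply/negPn/negP => /fl.
  have := le (x |: F); have /eqP -> : (x |: F) :\: S == set0.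
    by rewrite setD_eq0 subUset sub1set xS.
  by rewrite cards0; lia.
have rkF := rk_two_bound F.
have [e|e] := eqVneq (rk M F) #|F|.
  have [->|/set0Pn[x xF]] := eqVneq F set0; first by [].
  by have := noc x xF; have := rk_le_card M (F :\ x); have := cardsD1 x F; rewrite xF; lia.
have [e'|e'] := eqVneq (rk M F) r.
  have -> : F = [set: E].
    apply/setP => x; rewrite inE; apply/negPn/negP => /fl; rewrite e'.
    by rewrite rk_two_bound; lia.
  by rewrite eqxx !orbT.
have [eA|eA] := eqVneq (rk M F) (a + #|F :\: A|).
  by rewrite (sub A) ?orbT // => X; rewrite rk_two_bound; lia.
by rewrite (sub B) ?orbT // => [|X]; rewrite rk_two_bound; lia.
Qed.

End TwoBounds.

(** Both lattices consist of bottom, top and two incomparable elements, with ranks 0, [a], [a], [r];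
    the size of [A :&: B] does not enter. *)
Lemma two_bound_same_configuration (E E' : finType) (a r : nat)
    (A B : {set E}) (A' B' : {set E'})
    (hAB : #|A :&: B| + r <= a + a) (hAB' : #|A' :&: B'| + r <= a + a) :
  0 < a -> a < r -> a < #|A| -> a < #|B| -> #|A'| = #|A| -> #|B'| = #|B| ->
  #|E'| = #|E| -> r < a + #|~: A| -> r < a + #|~: B| ->
  same_configuration (two_bound hAB) (two_bound hAB').
Proof.
move=> a0 ar aA aB eA eB eE rA rB.
have aA' : a < #|A'| by rewrite eA.
have aB' : a < #|B'| by rewrite eB.
have rA' : r < a + #|~: A'| by have := cardsC A; have := cardsC A'; lia.
have rB' : r < a + #|~: B'| by have := cardsC B; have := cardsC B'; lia.
have gt0 (T : finType) (X : {set T}) : a < #|X| -> (X == set0 = false).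
  by move=> h; rewrite -cards_eq0; lia.
have ltT (T : finType) (X : {set T}) : r < a + #|~: X| -> (X == [set: T] = false).
  by move=> h; apply/negP=> /eqP e; move: h; rewrite e setCT cards0; lia.
have T0 (T : finType) (X : {set T}) : a < #|X| -> ([set: T] == set0 = false).
  by move=> h; apply: gt0; have := subset_leq_card (subsetT X); lia.
have nAB := negPf (two_bound_AB hAB ar aA).
have nBA := negPf (two_bound_BA hAB ar aB).
have nAB' := negPf (two_bound_AB hAB' ar aA').
have nBA' := negPf (two_bound_BA hAB' ar aB').
have neqAB : B == A = false by apply/negP=> /eqP e; move: nAB; rewrite e subxx.
pose f (X : {set E}) : {set E'} := if X == A then A' else if X == B then B'
  else if X == [set: E] then [set: E'] else set0.
have fA : f A = A' by rewrite /f eqxx.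
have fB : f B = B' by rewrite /f eqxx neqAB.
have fT : f [set: E] = [set: E'].
  by rewrite /f eqxx ![[set: E] == _]eq_sym !ltT.
have f0 : f set0 = set0 
  by rewrite /f ![set0 == _]eq_sym !gt0 //; have := subset_leq_card (subsetT A); lia.
have cf := two_bound_cyclic_flats hAB a0 ar aA aB rA rB.
have cf' := two_bound_cyclic_flats hAB' a0 ar aA' aB' rA' rB'.
have mono : {in cyclic_flats (two_bound hAB) &, {mono f : F G / F \subset G}}.
  move=> F G; rewrite cf !inE.
  by case/orP=> [/orP[/orP[]|]|] /eqP-> /orP[/orP[/orP[]|]|] /eqP->;
    rewrite ?f0 ?fA ?fB ?fT ?sub0set ?subsetT ?subxx ?nAB ?nBA ?nAB' ?nBA'
      ?subset0 ?subTset ?(T0 _ A aA) ?(T0 _ A' aA') ?gt0 ?ltT.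
exists f; split => //.
- move=> F G cF cG e; apply/eqP.
  by rewrite eqEsubset -(mono F G) // -(mono G F) // e !subxx.
- by rewrite cf cf' !imsetU !imset_set1 f0 fA fB fT.
- move=> F; rewrite cf !inE.
  by case/orP=> [/orP[/orP[]|]|] /eqP->; rewrite ?f0 ?fA ?fB ?fT ?cards0 ?cardsT.
- move=> F; rewrite cf !inE.
  case/orP=> [/orP[/orP[]|]|] /eqP->; rewrite ?f0 ?fA ?fB ?fT.
  + by apply/eqP; rewrite eqn_leq !(leq_trans (rk_le_card _ _)) // cards0.
  + by rewrite !rk_two_boundA.
  + by rewrite !rk_two_boundB.
  + by rewrite -!/(mrank _) !mrank_two_bound.
Qed.

(** * Branch-width from below *)

Section TreeComponents.
Variables (V : finType) (e : rel V).
Hypothesis treeV : is_tree e.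

Lemma del_edge_sym (u v : V) : symmetric (del_edge e u v).
Proof.
have [_ es _ _ _] := treeV.
move=> x y; rewrite /del_edge /= es; congr (_ && _).
by rewrite !xpair_eqE andbC (andbC (x == v)) (andbC (x == u)).
Qed.

(** A simple path avoiding the edge would close up with it to a cycle; the length bound of [is_tree]
    leaves only the deleted edge itself. *)
Lemma del_edge_separates (u v : V) : e u v -> ~~ connect (del_edge e u v) u v.
Proof.
have [_ es ei _ cyc] := treeV.
move=> uv; apply/negP => /connectP[p0 /shortenP[p pp up _] ev].
have : ucycle e (u :: p).
  rewrite /ucycle up andbT /= rcons_path -ev es uv andbT.
  by apply: sub_path pp => x y /and3P[].
move/cyc; case: p pp up ev => [|x [|//]] /=; first by move=> _ _ vu; rewrite vu ei in uv.
by move=> /andP[/and3P[_ n _] _] _ vx; rewrite vx eqxx in n.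
Qed.

(* A path that stays away from u cannot use an edge at u. *)
Lemma connect_avoid (u v w z : V) (p : seq V) :
  path e w p -> u \notin w :: p -> z = last w p ->
  connect (del_edge e u v) w z && connect (del_edge e v u) w z.
Proof.
move=> pp up ->; apply/andP; split; apply/connectP; exists p => //;
  apply: (sub_in_path (P := [pred x | x != u])) pp => /=;
  try by apply/andP; split; [|apply/allP => x xp] => /=;
    apply: contraNneq up => <-; rewrite !inE ?eqxx ?xp ?orbT.
all: move=> x y; rewrite !inE => xu yu exy; rewrite /del_edge /= exy !xpair_eqE.
all: by rewrite (negPf xu) (negPf yu) ?andbF.
Qed.

(** The first step of a simple path from [u] picks [w], and the rest never returns to [u]. This
    splits the [u]-side of [uv] into sides at the other neighbours of [u]. *)
Lemma connect_del_edge_step (u v z : V) :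
  connect (del_edge e u v) u z -> z != u ->
  exists w, [/\ e u w, w != v & connect (del_edge e w u) w z].
Proof.
move=> /connectP[p0 /shortenP[p pp up _] ez] zu.
case: p pp up ez => [|w p] /=; first by move=> _ _ ez; rewrite ez eqxx in zu.
move=> /andP[/and3P[uw n _] pp] /andP[up _] ez; exists w; split=> //.
  by apply: contraNneq n => ->.
have pe : path e w p by apply: sub_path pp => x y /and3P[].
by have /andP[] := connect_avoid w pe up ez.
Qed.

Lemma connect_del_edge_sub (u v w z : V) :
  e u v -> e u w -> w != v ->
  connect (del_edge e w u) w z -> connect (del_edge e u v) u z.
Proof.
have [_ es ei _ _] := treeV.
move=> uv uw wv /connectP[p pp ez].
have pe : path e w p by apply: sub_path pp => x y /and3P[].
have up : u \notin w :: p.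
  apply/negP=> upp; have /negP[] := @del_edge_separates w u (etrans (es w u) uw).
  by apply: (path_connect pp).
have uvw : del_edge e u v u w.
  rewrite /del_edge /= uw !xpair_eqE eqxx (negPf wv) /=.
  by apply/negP => /andP[/eqP h _]; rewrite h ei in uv.
apply: connect_trans (connect1 uvw) _.
by have /andP[] := connect_avoid v pe up ez.
Qed.

End TreeComponents.

(* Take a directed edge uv whose u-side spans, with the u-side containing as few
   vertices as possible. Then u is an inner vertex, and the three sides of the
   tree at u are non-spanning sets that cover the ground set. *)
Lemma bd_width_spanning (E : finType) (M : matroid E) (D : branch_decomposition E) (x0 : E) :
  1 < mrank M ->
  (forall x, mrank M <= rk M ([set: E] :\ x)) ->
  (forall X1 X2 X3 : {set E}, rk M X1 < mrank M -> rk M X2 < mrank M ->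
     rk M X3 < mrank M -> X1 :|: X2 :|: X3 != [set: E]) ->
  mrank M < bd_width M D.
Proof.
move=> r_gt1 rk1 cover3; rewrite ltnNge; apply/negP => wD.
have tD := bd_tree D; have [_ es ei conn _] := tD.
set e := (@bd_edge E D) in tD es ei conn *; pose V := bd_vertex D.
have lamD (u v : V) : e u v -> lambda M (displayed u v) < mrank M.
  move=> uv; apply: leq_trans wD; rewrite -addn1.
  exact: (@leq_bigmax_cond _ (fun p : V * V => e p.1 p.2)
    (fun p => lambda M (displayed p.1 p.2) + 1) (u, v)).
pose big (p : V * V) := e p.1 p.2 && (mrank M <= rk M (displayed p.1 p.2)).
pose comp (p : V * V) := [set z | connect (del_edge e p.1 p.2) p.1 z].
(* The edge at the leaf of [x0], directed away from it, displays every element except [x0], which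
   spans by [rk1]. *)
have [p0 bp0] : exists p, big p.
  pose l := bd_label D x0; have /cards1P[v ev] := bd_label_leaf D x0.
  have lv : e l v by move/setP/(_ v): ev; rewrite !inE eqxx.
  exists (v, l); rewrite /big /= es lv; apply: leq_trans (rk1 x0) _; apply: rkS.
  apply/subsetP=> y; rewrite !inE andbT => yx.
  have /connectP[p0' /shortenP[p pp up _] ey] := conn l (bd_label D y).
  case: p pp up ey => [|w p] /=; first by move=> _ _ /(@bd_label_inj E D) ey; rewrite ey eqxx in yx.
  move=> /andP[lw pp] /andP[up _] ey.
  have wv : w = v by apply/set1P; rewrite -ev inE.
  by rewrite -wv; have /andP[] := connect_avoid w pp up ey.
have [[u v] bp minp] : exists2 p, big p & forall q, big q -> #|comp p| <= #|comp q|.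
  by case: (arg_minnP (fun p => #|comp p|) bp0) => p bp mp; exists p.
case/andP: bp => /= uv buv.
have small w : e u w -> w != v -> rk M (displayed w u) < mrank M.
  move=> uw wv; rewrite ltnNge; apply/negP => bw.
  have /minp : big (w, u) by rewrite /big /= es uw.
  apply/negP; rewrite -ltnNge; apply: proper_card; apply/properP; split.
    by apply/subsetP=> z; rewrite !inE; exact: (connect_del_edge_sub tD uv uw wv).
  exists u; first by rewrite inE connect0.
  by rewrite inE /=; apply: (del_edge_separates tD); rewrite es.
(* Since the [u]-side has full rank, [lambda] equals the rank of the other side. *)
have smallC : rk M (~: displayed u v) < mrank M.
  have := lamD u v uv; rewrite /lambda.
  have := rkS M (subsetT (displayed u v)); rewrite -/(mrank M); lia.
(* At a leaf [u] the displayed set has at most one element, too few to span as [1 < mrank M]. *)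
have [lu|nlu] := boolP (is_leaf e u).
  have /cards1P[v' ev] := lu.
  have nb w : e u w -> w = v.
    move=> uw; have := uv; have : w \in [set w | e u w] by rewrite inE.
    rewrite ev => /set1P -> {uw} uw; have : v \in [set w | e u w] by rewrite inE.
    by rewrite ev => /set1P.
  have le1 : #|displayed u v| <= 1.
    rewrite leqNgt; apply/negP => /card_gt1P[x [y [xd yd xy]]].
    have at_u z : z \in displayed u v -> bd_label D z = u.
      rewrite inE => c; apply/eqP/negPn/negP => zu.
      by have [w [/nb -> /eqP]] := connect_del_edge_step c zu.
    by move/negP: xy; apply; apply/eqP/(@bd_label_inj E D); rewrite !at_u.
  by have := rk_le_card M (displayed u v); lia.
have /eqP := bd_cubic nlu; rewrite /degree -/e (cardsD1 v) inE uv add1n eqSS.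
move=> /cards2P[w1 [w2 [_ ew]]].
have mem w : e u w -> w != v -> w \in [set w1; w2] by move=> ? ?; rewrite -ew !inE; apply/andP.
have [w1v uw1] : w1 != v /\ e u w1.
  by have : w1 \in [set w1; w2] by [rewrite !inE eqxx]; rewrite -ew !inE => /andP.
have [w2v uw2] : w2 != v /\ e u w2.
  by have : w2 \in [set w1; w2] by [rewrite !inE eqxx orbT]; rewrite -ew !inE => /andP.
apply/negP: (cover3 _ _ _ smallC (small w1 uw1 w1v) (small w2 uw2 w2v)); rewrite negbK.
rewrite -subTset; apply/subsetP => z _; rewrite !inE.
have [c|//] := boolP (connect _ u _); rewrite /=.
have zu : bd_label D z != u by apply: contraNneq nlu => <-; exact: bd_label_leaf.
have [w [uw wv cw]] := connect_del_edge_step c zu.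
by have := mem w uw wv; rewrite !inE => /orP[] /eqP <-; rewrite cw ?orbT.
Qed.

(** * Branch-width from above *)

Section ParentTree.
Variables (N : nat) (par : nat -> nat).
Hypothesis par_lt : forall i, 0 < i -> par i < i.

Definition parent_edge : rel 'I_N.+1 :=
  [rel x y : 'I_N.+1 | ((0 < x) && (par x == y)) || ((0 < y) && (par y == x))].

Lemma parent_edge_sym : symmetric parent_edge.
Proof. by move=> x y; rewrite /parent_edge /= orbC. Qed.

Lemma parent_edge_le (x y : 'I_N.+1) : parent_edge x y -> y <= x -> par x = y.
Proof.
case/orP=> /andP[y0 /eqP e] yx; first by [].
by have := par_lt y0; lia.
Qed.

Lemma par_ltN (x : 'I_N.+1) : 0 < x -> par x < N.+1.
Proof. by move/par_lt => h; exact: ltn_trans h (ltn_ord x). Qed.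

(** Climbing to parents never enters [S] and ends at 0. Taking [S] empty gives connectedness of the
    tree; taking [S] to be the descendants of a vertex treats the tree with an edge deleted. *)
Lemma parent_connect0 (d : rel 'I_N.+1) (S : pred nat) :
  (forall x y : 'I_N.+1, ~~ S x -> 0 < x -> par x = y -> d x y) ->
  (forall i, 0 < i -> S (par i) -> S i) ->
  forall x : 'I_N.+1, ~~ S x -> connect d x ord0.
Proof.
move=> dS Spar x; have [k] := ubnP (x : nat); elim: k x => // k IH x xk Sx.
have [x0|x0] := posnP x; first by rewrite (_ : x = ord0) ?connect0 //; apply: val_inj.
have lt := par_lt x0; apply: (@connect_trans _ _ (Ordinal (par_ltN x0))).
  exact/connect1/dS.
by apply: IH => /=; [lia|apply: contra Sx; exact: Spar].
Qed.

Lemma parent_tree : is_tree parent_edge.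
Proof.
split.
- by rewrite card_ord.
- exact: parent_edge_sym.
- by move=> x; apply/negP => h; have := parent_edge_le h (leqnn _);
    case/orP: h => /andP[/par_lt]; lia.
- have c0 (x : 'I_N.+1) : connect parent_edge x ord0.
    apply: (@parent_connect0 _ pred0) => // y z _ y0 e.
    by rewrite /parent_edge /= y0 e eqxx.
  move=> x y; apply: connect_trans (c0 x) _.
  by rewrite (sym_connect_sym parent_edge_sym).
- case=> [//|x0 c0]; set c := x0 :: c0; move=> uc.
  (* Both cycle neighbours of the largest vertex are smaller, hence both are its parent, which rules
     out a third vertex. *)
  pose x := [arg max_(i > x0 in c) (i : nat)].
  have [xc xmax] : x \in c /\ forall y, y \in c -> y <= x.
    by rewrite /x; case: arg_maxnP; rewrite ?inE ?eqxx // => i ic im; split => // y /im.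
  have [i s rc] := rot_to xc.
  have : ucycle parent_edge (x :: s) by rewrite -rc rot_ucycle.
  have -> : size c = size (x :: s) by rewrite -rc size_rot.
  have {}xmax y : y \in x :: s -> y <= x by rewrite -rc mem_rot; exact: xmax.
  case: s xmax {rc} => [//|y s] xmax; case/andP=> /=.
  rewrite rcons_path => /andP[xy /andP[_ lx]] /and3P[_ ys us].
  have py := parent_edge_le xy (xmax y (mem_behead (s := x :: _) (mem_head y s))).
  rewrite parent_edge_sym in lx.
  have pl := parent_edge_le lx (xmax _ (mem_behead (s := x :: _) (mem_last y s))).
  have yl : y = last y s by apply: val_inj; rewrite /= -py -pl.
  by case/lastP: s ys yl {lx pl xmax us} => // s z; rewrite last_rcons mem_rcons inE => yz e; rewrite e eqxx in yz.
Qed.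

(* S is the set of descendants of u. *)
Lemma parent_del_edge (u v : 'I_N.+1) (S : pred nat) : 0 < u -> par u = v ->
  S u -> ~~ S v ->
  (forall w, S w -> w != u -> S (par w)) ->
  (forall w, 0 < w -> S (par w) -> S w) ->
  (forall z : 'I_N.+1, connect (del_edge parent_edge u v) u z -> S z) /\
  (forall z : 'I_N.+1, ~~ S z -> connect (del_edge parent_edge v u) v z).
Proof.
move=> u0 uv Su Sv up down; split=> z.
  case/connectP=> p pp ->; elim: p {-2}u Su pp => [|y p IH] x Sx //=.
  case/andP=> /and3P[xy n _] /IH; apply.
  case/orP: xy => /andP[h /eqP e]; last by apply: down => //; rewrite e.
  rewrite -e; apply: up => //; apply: contra n => /eqP xu.
  have -> : x = u by apply: val_inj.
  by rewrite xpair_eqE eqxx; apply/eqP/val_inj; rewrite /= -e xu.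
have dS (x y : 'I_N.+1) : ~~ S x -> 0 < x -> par x = y -> del_edge parent_edge v u x y.
  move=> Sx x0 xy; rewrite /del_edge /parent_edge /= x0 xy eqxx /= !xpair_eqE.
  have xu : x != u by apply: contraNneq Sx => ->.
  rewrite (negPf xu) andbT; apply/negP => /andP[_ /eqP yu].
  by case/negP: Sx; apply: down => //; rewrite xy yu.
move=> Sz; apply: connect_trans (parent_connect0 dS down Sv) _.
by rewrite (sym_connect_sym (del_edge_sym parent_tree v u)); exact: parent_connect0 dS down _ Sz.
Qed.

End ParentTree.

(* Three caterpillars glued at the vertex 0. The caterpillar number c < 3 has
   spine vertices 6t + c + 1 and leaves 6t + c + 4. *)
Definition spider_parent (i : nat) : nat :=
  if i <= 3 then 0 else if 3 <= i.-1 %% 6 then i - 3 else i - 6.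

Lemma spider_parent_lt i : 0 < i -> spider_parent i < i.
Proof. by rewrite /spider_parent; case: ifP => _; [|case: ifP]; lia. Qed.

Section Spider.
Variable L : nat.
Notation edge := (@parent_edge (6 * L + 3) spider_parent).

Lemma spider_leaf (v : 'I_(6 * L + 3).+1) : 3 <= v.-1 %% 6 -> is_leaf edge v.
Proof.
move=> hv; rewrite /is_leaf /degree; apply/cards1P.
have wm : v - 3 < (6 * L + 3).+1 by have := ltn_ord v; lia.
exists (Ordinal wm); apply/setP => w; rewrite !inE -val_eqE /parent_edge /= /spider_parent.
by apply/idP/idP; repeat case: ifP; lia.
Qed.

Lemma spider_cubic (v : 'I_(6 * L + 3).+1) :
  ~~ is_leaf edge v -> degree edge v = 3.
Proof.
have [lv /negP[]|lv] := leqP 3 (v.-1 %% 6); first exact: spider_leaf.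
have vN := ltn_ord v.
have card3 (x y z : 'I_(6 * L + 3).+1) : x < y -> y < z ->
    [set w | edge v w] = [set x; y; z] -> degree edge v = 3.
  move=> xy yz e; rewrite /degree e setUC cardsU1 cards2 !inE -!val_eqE.
  have -> : val z == val x = false by rewrite /=; lia.
  have -> : val z == val y = false by rewrite /=; lia.
  by have -> : val x != val y by rewrite /=; lia.
have [v0|v0] := posnP v.
  have h1 : 1 < (6 * L + 3).+1 by lia.
  have h2 : 2 < (6 * L + 3).+1 by lia.
  have h3 : 3 < (6 * L + 3).+1 by lia.
  move=> _; apply: (card3 (Ordinal h1) (Ordinal h2) (Ordinal h3)) => //.
  apply/setP => w; rewrite !inE -!val_eqE /parent_edge /= /spider_parent.
  by apply/idP/idP; repeat case: ifP; lia.
have pm : spider_parent v < (6 * L + 3).+1 by have := spider_parent_lt v0; lia.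
have [vm|vm] := leqP (v + 6) (6 * L + 3).
  have am : v + 3 < (6 * L + 3).+1 by lia.
  have bm : v + 6 < (6 * L + 3).+1 by lia.
  move=> _; apply: (card3 (Ordinal pm) (Ordinal am) (Ordinal bm)) => /=; first by have := spider_parent_lt v0; lia.
    by lia.
  apply/setP => w; rewrite !inE -!val_eqE /parent_edge /= /spider_parent.
  by apply/idP/idP; repeat case: ifP; lia.
(* The last spine vertex [6L + c + 1] of a caterpillar has no children within range, so it is an
   unlabelled leaf. *)
case/negP; rewrite /is_leaf /degree; apply/cards1P.
exists (Ordinal pm); apply/setP => w; rewrite !inE -val_eqE /parent_edge /=.
have := ltn_ord w; rewrite /spider_parent.
by move=> ?; apply/idP/idP; repeat case: ifP; lia.
Qed.

Lemma spider_del_edge (u v : 'I_(6 * L + 3).+1) : 0 < u -> spider_parent u = v ->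
  (forall z : 'I_(6 * L + 3).+1,
     connect (del_edge edge u v) u z -> z.-1 %% 3 = u.-1 %% 3) /\
  (forall z : 'I_(6 * L + 3).+1, 0 < z -> z.-1 %% 3 <> u.-1 %% 3 ->
     connect (del_edge edge v u) v z).
Proof.
move=> u0 uv.
(* The descendants of [u]: only [u] for a leaf, its caterpillar from [u] on for a spine vertex.
   Modulo 3, [w.-1] is the caterpillar number for spine vertices and leaves alike. *)
pose S (w : nat) := (w == u :> nat) || [&& u.-1 %% 6 < 3, u <= w & w.-1 %% 3 == u.-1 %% 3].
have [||||h1 h2] := @parent_del_edge (6 * L + 3) spider_parent spider_parent_lt u v S u0 uv.
- by rewrite /S eqxx.
- by have := spider_parent_lt u0; rewrite /S uv; lia.
- by move=> w; rewrite /S /spider_parent; repeat case: ifP; lia.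
- by move=> w; rewrite /S /spider_parent; repeat case: ifP; lia.
split=> z; first by move/h1; rewrite /S => /orP[/eqP->//|/and3P[_ _ /eqP]].
move=> z0 ne; apply: h2; rewrite /S negb_or; apply/andP; split.
  by apply/eqP=> e; rewrite e in ne.
by rewrite (introF eqP ne) !andbF.
Qed.

(** One side of each edge lies in a single arm, and [lambda] agrees on both sides and is at most the
    rank of either. *)
Lemma bw_spider (E : finType) (M : matroid E) (k : nat) (arm pos : E -> nat) :
  (forall x, arm x < 3) -> (forall x, pos x < L) ->
  (forall x y, arm x = arm y -> pos x = pos y -> x = y) ->
  (forall c, rk M [set x | arm x == c] <= k) -> bw M <= k.+1.
Proof.
move=> arm3 posL inj rkM.
have lm (x : E) : 6 * pos x + arm x + 4 < (6 * L + 3).+1.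
  by have := arm3 x; have := posL x; lia.
have linj : injective (fun x => Ordinal (lm x)).
  by move=> x y [] e; have := arm3 x; have := arm3 y; move=> *; apply: inj; lia.
have leaf x : is_leaf edge (Ordinal (lm x)).
  by apply: spider_leaf => /=; have := arm3 x; lia.
have lab x : (6 * pos x + arm x + 4).-1 %% 3 = arm x by have := arm3 x; lia.
pose D := BranchDecomposition (parent_tree (6 * L + 3) spider_parent_lt) spider_cubic linj leaf.
suff wD : bd_width M D <= k.+1.
  rewrite /bw; case: ex_minnP => m _ /(_ (bd_width M D)) h.
  by apply: leq_trans wD; apply: h; apply/asboolP; exists D.
have sub (X : {set E}) c : X \subset [set x | arm x == c] -> lambda M X <= k.
  by move=> h; apply: leq_trans (lambda_le_rk _ _) (leq_trans (rkS _ h) (rkM c)).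
apply/bigmax_leqP => -[u v] /= uv; rewrite addn1 ltnS.
case/orP: uv => /andP[u0 /eqP /(spider_del_edge u0)[h1 h2]].
  by apply: (sub _ (u.-1 %% 3)); apply/subsetP => x; rewrite !inE => /h1 <- /=; rewrite lab.
rewrite -lambdaC; apply: (sub _ (v.-1 %% 3)); apply/subsetP => x; rewrite !inE.
by apply: contraR => /eqP ne; apply: h2; rewrite //= ?lab // addn4.
Qed.

End Spider.

(** * Minors of products and of staircase matrices *)

Section IncreasingMaps.
Variables (k m : nat).

Lemma increasing_inj (f : 'I_k -> 'I_m) : {homo f : i j / i < j} -> injective f.
Proof.
move=> hf i j e; apply: val_inj => /=.
by case: (ltngtP i j) => // /hf; rewrite e ltnn.
Qed.

Lemma increasing_enum (S : {set 'I_m}) : #|S| = k ->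
  exists f : 'I_k -> 'I_m, {homo f : i j / i < j} /\ f @: [set: 'I_k] = S.
Proof.
move=> eS; pose f (i : 'I_k) : 'I_m := enum_val (cast_ord (esym eS) i).
have hf : {homo f : i j / i < j}.
  move=> i j ij; rewrite /f; have x0 := f i.
  have tr : transitive (fun x y : 'I_m => x < y) by move=> y x z; exact: ltn_trans.
  have so : sorted (fun x y : 'I_m => x < y) (enum S).
    rewrite /enum_mem sorted_filter // -enumT.
    have := iota_ltn_sorted 0 m; rewrite -val_enum_ord sorted_map.
    by apply: sub_sorted.
  by rewrite !(enum_val_nth x0); apply: (sorted_ltn_nth tr) => //;
    rewrite inE -cardE ltn_ord.
exists f; split=> //; apply/eqP; rewrite eqEcard; apply/andP; split.
  by apply/subsetP => _ /imsetP[i _ ->]; exact: enum_valP.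
by rewrite card_imset ?cardsT ?card_ord ?eS //; exact: increasing_inj.
Qed.

Lemma increasing_sort (f : 'I_k -> 'I_m) : injective f ->
  exists s : 'S_k, {homo (f \o s) : i j / i < j}.
Proof.
move=> injf; have [|g [hg eg]] := @increasing_enum (f @: [set: 'I_k]).
  by rewrite card_imset // cardsT card_ord.
have /fin_all_exists[h fh] (i : 'I_k) : exists j, f j = g i.
  have : g i \in f @: [set: 'I_k] by rewrite -eg imset_f.
  by case/imsetP=> j _ ->; exists j.
have injh : injective h.
  by move=> i j e; apply: (increasing_inj hg); rewrite -!fh e.
by exists (perm injh) => i j ij; rewrite /= !permE !fh hg.
Qed.

End IncreasingMaps.

Section CauchyBinet.
Local Open Scope ring_scope.

Section Expansion.
Variables (R : comNzRingType) (k m : nat).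
Implicit Types (P : 'M[R]_(k, m)) (Q : 'M[R]_(m, k)) (f : 'I_k -> 'I_m).

Lemma det_mulmx_rect P Q :
  \det (P *m Q) =
    \sum_(f : {ffun 'I_k -> 'I_m}) (\prod_i P i (f i)) * \det (rowsub f Q).
Proof.
rewrite /determinant.
under eq_bigr => s _.
  under eq_bigr => i _ do rewrite mxE.
  rewrite bigA_distr_bigA /= big_distrr /=.
  over.
rewrite exchange_big; apply: eq_bigr => f _; rewrite big_distrr /=.
apply: eq_bigr => s _; rewrite big_split mulrCA; congr (_ * (_ * _)).
by apply: eq_bigr => i _; rewrite mxE.
Qed.

Lemma det_rowsub_perm Q f (s : 'S_k) :
  \det (rowsub (f \o s) Q) = (-1) ^+ s * \det (rowsub f Q).
Proof.
rewrite (_ : rowsub _ _ = row_perm s (rowsub f Q)); last by apply/matrixP=> i j; rewrite !mxE.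
by rewrite row_permE det_mulmx det_perm.
Qed.

Lemma det_colsub_perm P f (s : 'S_k) :
  \det (colsub (f \o s) P) = (-1) ^+ s * \det (colsub f P).
Proof.
rewrite (_ : colsub _ _ = col_perm s (colsub f P)); last by apply/matrixP=> i j; rewrite !mxE.
by rewrite col_permE det_mulmx det_perm odd_permV mulrC.
Qed.

(* The Cauchy-Binet formula, summed over all maps instead of the increasing ones:
   every k-subset of rows is counted once for each of its k! orderings. *)
Lemma Cauchy_Binet P Q :
  k`!%:R * \det (P *m Q) =
    \sum_(f : {ffun 'I_k -> 'I_m}) \det (colsub f P) * \det (rowsub f Q).
Proof.
(* Reindexing by [f \o s] moves the sign of [s] onto the product; summing over all [s] then
   assembles [\det (colsub f P)]. *)
have e (s : 'S_k) : \det (P *m Q) = \sum_(f : {ffun 'I_k -> 'I_m})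
    ((-1) ^+ s * \prod_i P i (f (s i))) * \det (rowsub f Q).
  rewrite det_mulmx_rect; pose h (t : 'S_k) (f : {ffun 'I_k -> 'I_m}) := [ffun i => f (t i)].
  rewrite (reindex (h s)); last first.
    exists (h s^-1%g) => f _; apply/ffunP => i; rewrite !ffunE.
      by rewrite permKV.
    by rewrite permK.
  apply: eq_bigr => f _; rewrite -mulrA mulrCA -det_rowsub_perm; congr (_ * _).
    by apply: eq_bigr => i _; rewrite ffunE.
  by congr (\det _); apply/matrixP => i j; rewrite !mxE ffunE.
have -> : k`!%:R * \det (P *m Q) = \sum_(s : 'S_k) \det (P *m Q).
  by rewrite sumr_const card_Sn mulr_natl.
under eq_bigr => s _ do rewrite (e s).
rewrite exchange_big; apply: eq_bigr => f _; rewrite -big_distrl /=.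
by congr (_ * _); apply: eq_bigr => s _; congr (_ * _); apply: eq_bigr => i _; rewrite mxE.
Qed.

Lemma det_rowsub_inj Q f : \det (rowsub f Q) != 0 -> injective f.
Proof.
move=> nz i j e; apply/eqP/negPn/negP => ij; case/negP: nz; apply/eqP.
by apply: (determinant_alternate ij) => l; rewrite !mxE e.
Qed.

End Expansion.

Section Positivity.
Variables (R : realFieldType) (k m : nat) (P : 'M[R]_(k, m)) (Q : 'M[R]_(m, k)).
Hypothesis P_gt0 : forall f : 'I_k -> 'I_m,
  {homo f : i j / (i < j)%N} -> 0 < \det (colsub f P).
Hypothesis Q_ge0 : forall f : 'I_k -> 'I_m,
  {homo f : i j / (i < j)%N} -> 0 <= \det (rowsub f Q).

(** Sorting an injective [f] multiplies both minors by the same sign, which cancels. *)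
Lemma minor_product (f : 'I_k -> 'I_m) :
  \det (colsub f P) * \det (rowsub f Q) = 0 \/
  exists2 g : 'I_k -> 'I_m, {homo g : i j / (i < j)%N} &
    \det (rowsub g Q) != 0 /\
    \det (colsub f P) * \det (rowsub f Q) = \det (colsub g P) * \det (rowsub g Q).
Proof.
have [->|nz] := eqVneq (\det (rowsub f Q)) 0; first by left; rewrite mulr0.
have [s hs] := increasing_sort (det_rowsub_inj nz).
right; exists (f \o s) => //; rewrite det_rowsub_perm det_colsub_perm mulf_neq0 ?signr_eq0 //.
by split=> //; rewrite mulrACA -expr2 sqrr_sign mul1r.
Qed.

Lemma minor_product_ge0 (f : 'I_k -> 'I_m) :
  0 <= \det (colsub f P) * \det (rowsub f Q).
Proof.
have [->//|[g hg [_ ->]]] := minor_product f.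
by rewrite mulr_ge0 ?Q_ge0 // ltW // P_gt0.
Qed.

Lemma det_mulmx_ge0 : 0 <= \det (P *m Q).
Proof.
rewrite -(pmulr_rge0 _ (_ : 0 < k`!%:R)) ?ltr0n ?fact_gt0 // Cauchy_Binet.
by apply: sumr_ge0 => f _; exact: minor_product_ge0.
Qed.

(** All Cauchy-Binet terms are nonnegative, so nothing cancels. Hence multiplying by [P] truncates
    the column matroid to rank [k], as a generic matrix would. *)
Lemma det_mulmx_neq0 : \det (P *m Q) != 0 <->
  exists2 f : 'I_k -> 'I_m, {homo f : i j / (i < j)%N} & \det (rowsub f Q) != 0.
Proof.
have fact_neq0 : k`!%:R != 0 :> R by rewrite pnatr_eq0 -lt0n fact_gt0.
split=> [nz|[f hf nz]].
  have : k`!%:R * \det (P *m Q) != 0 by rewrite mulf_neq0.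
  rewrite Cauchy_Binet => nz'; apply: contrapT => none.
  case/negP: nz'; apply/eqP; apply: big1 => f _.
  by have [//|[g hg [ng _]]] := minor_product f; case: none; exists g.
have : 0 < k`!%:R * \det (P *m Q).
  rewrite Cauchy_Binet (bigD1 [ffun i => f i]) //=.
  apply: ltr_wpDr; first by apply: sumr_ge0 => g _; exact: minor_product_ge0.
  have -> : colsub [ffun i => f i] P = colsub f P by apply/matrixP => i j; rewrite !mxE ffunE.
  have -> : rowsub [ffun i => f i] Q = rowsub f Q by apply/matrixP => i j; rewrite !mxE ffunE.
  by rewrite mulr_gt0 ?P_gt0 // lt0r nz Q_ge0.
by move/lt0r_neq0; apply: contraNneq => ->; rewrite mulr0.
Qed.

End Positivity.

Lemma Vandermonde_minor_gt0 (R : realFieldType) (k m : nat) (f : 'I_k -> 'I_m) :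
  {homo f : i j / (i < j)%N} ->
  0 < \det (colsub f (Vandermonde k (\row_(j < m) j%:R : 'rV[R]_m))).
Proof.
move=> hf; rewrite (_ : colsub _ _ = Vandermonde k (\row_i (f i)%:R)); last first.
  by apply/matrixP => i j; rewrite !mxE.
rewrite det_Vandermonde; apply: prodr_gt0 => i _; apply: prodr_gt0 => j ij.
by rewrite !mxE subr_gt0 ltr_nat hf.
Qed.

End CauchyBinet.

(* A staircase matrix with entries T^(a_i b_j): by the rearrangement inequality
   the identity is the unique permutation of largest weight, so that its term
   dominates the determinant once T is at least the number of permutations. *)
Section Staircase.
Variables (k : nat) (a b : 'I_k -> nat) (s : 'I_k -> 'I_k -> bool).
Hypothesis a_incr : {homo a : i j / i < j}.
Hypothesis b_incr : {homo b : i j / i < j}.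
Hypothesis s_stair : forall i i' j j' : 'I_k, i < i' -> j < j' ->
  s i j' -> s i' j -> s i j && s i' j'.

Let weight (t : 'S_k) := \sum_i a i * b (t i).
Let feasible (t : 'S_k) := [forall i, s i (t i)].

Lemma perm_inversion (t : 'S_k) : t != 1%g -> exists i j : 'I_k, i < j /\ t j < t i.
Proof.
move=> t1; have [i0 ti0] : exists i, t i != i.
  apply: contrapT => h; case/eqP: t1; apply/permP => i; rewrite perm1.
  by apply/eqP/negPn/negP => n; apply: h; exists i.
(* Everything below the least moved point [i] is fixed, so both [t i] and the preimage of [i] exceed
   [i], and these form an inversion. *)
have [i ti imin] : exists2 i, t i != i & forall j, t j != j -> i <= j.
  by case: (@arg_minnP _ i0 (fun i => t i != i) (@nat_of_ord k) ti0) => i ti mi; exists i.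
have fix_lt (j : 'I_k) : j < i -> t j = j.
  move=> ji; apply/eqP/negPn/negP => /imin; by rewrite leqNgt ji.
have lt_ti : i < t i.
  rewrite ltn_neqAle eq_sym ti leqNgt; apply/negP => /fix_lt /perm_inj e.
  by rewrite e eqxx in ti.
have tj : t ((t^-1)%g i) = i by rewrite permKV.
exists i, ((t^-1)%g i); rewrite tj; split=> //.
case: (ltngtP i ((t^-1)%g i)) => // [/fix_lt h|/val_inj h].
  by rewrite tj in h; rewrite -h in tj; rewrite tj eqxx in ti.
by rewrite -h in tj; rewrite tj eqxx in ti.
Qed.

(** Undoing an inversion [i < j] stays in the support by [s_stair] and raises the weight by
    [(a j - a i) * (b (t i) - b (t j))]. *)
Lemma feasible_swap (t : 'S_k) : feasible t -> t != 1%g ->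
  exists2 t', feasible t' & weight t < weight t'.
Proof.
move=> /forallP ft /perm_inversion[i [j [ij tij]]]; have ji : j != i by rewrite -val_eqE /= gtn_eqF.
exists (tperm i j * t)%g.
  have /andP[h1 h2] := s_stair ij tij (ft i) (ft j).
  apply/forallP => l; rewrite permM; case: tpermP => [->|->|_ _] //; exact: ft.
rewrite /weight (bigD1 i) //= (bigD1 j) //= [X in _ < X](bigD1 i) //= [X in _ < _ + X](bigD1 j) //=.
rewrite !permM tpermL tpermR !addnA.
rewrite [X in _ < _ + X](eq_bigr (fun l => a l * b (t l))); last first.
  by move=> l /andP[li lj]; rewrite permM tpermD // eq_sym.
by rewrite ltn_add2r; have := a_incr ij; have := b_incr tij; nia.
Qed.

Lemma weight_max (t : 'S_k) : feasible t -> feasible 1%g /\ weight t <= weight 1%g.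
Proof.
move=> ft; have [u fu um] : exists2 u, feasible u & forall v, feasible v -> weight v <= weight u.
  by case: (arg_maxnP weight ft) => u fu mu; exists u.
have [u1|u1] := eqVneq u 1%g; first by rewrite -u1; split=> //; exact: um.
by have [v /um h] := feasible_swap fu u1; rewrite ltnNge h.
Qed.

Lemma weight_lt (t : 'S_k) : feasible t -> t != 1%g -> weight t < weight 1%g.
Proof.
move=> ft t1; have [u /weight_max[_ h]] := feasible_swap ft t1.
by move=> /leq_trans; exact.
Qed.

Local Open Scope ring_scope.
Variables (R : realFieldType) (T : nat).
Hypothesis fact_le_T : (k`! <= T)%N.

Definition stair_mx : 'M[R]_k :=
  \matrix_(i, j) (if s i j then (T ^ (a i * b j))%:R else 0).

Let T_gt0 : (0 < T)%N. Proof. exact: leq_trans (fact_gt0 k) fact_le_T. Qed.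

Lemma stair_term (t : 'S_k) :
  \prod_i stair_mx i (t i) = if feasible t then (T ^ weight t)%:R else 0.
Proof.
case: ifPn => [/forallP ft|/forallPn[i ni]].
  rewrite /weight expn_sum natr_prod; apply: eq_bigr => i _.
  by rewrite mxE ft.
by rewrite (bigD1 i) //= mxE (negPf ni) mul0r.
Qed.

Lemma stair_det_neq0 : \det stair_mx != 0 -> forall i, s i i.
Proof.
move=> nz; suff /forallP h : feasible 1%g by move=> i; have := h i; rewrite perm1.
apply: contraNT nz => nf; apply/eqP; apply: big1 => t _.
rewrite stair_term ifN ?mulr0 //; apply: contra nf => /weight_max; by case.
Qed.

(** With [W] the weight of the identity, any other term times [T] is at least [-T^W]. There are
    [k! - 1 < T] of them, against [T * T^W] from the identity. *)
Lemma stair_det_gt0 : (forall i, s i i) -> 0 < \det stair_mx.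
Proof.
move=> si; have f1 : feasible 1%g by apply/forallP => i; rewrite perm1.
have TR : 0 < T%:R :> R by rewrite ltr0n.
have W0 : 0 < (T ^ weight 1%g)%:R :> R by rewrite ltr0n expn_gt0 T_gt0.
rewrite -(pmulr_lgt0 _ TR) /determinant (bigD1 1%g) //= odd_perm1 expr0 mul1r.
rewrite stair_term f1 mulrDl big_distrl /=.
have card1 : (#|[pred t : 'S_k | t != 1%g]|.+1 = k`!)%N.
  by rewrite (cardC1 (1%g : 'S_k)) card_Sn prednK ?fact_gt0.
have lb : - (T ^ weight 1%g)%:R *+ #|[pred t : 'S_k | t != 1%g]| <=
    \sum_(t : 'S_k | t != 1%g) (-1) ^+ t * \prod_i stair_mx i (t i) * T%:R :> R.
  rewrite -sumr_const; apply: ler_sum => t t1; rewrite stair_term.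
  have [ft|_] := boolP (feasible t); last by rewrite mulr0 mul0r oppr_le0 ltW.
  have le : (T ^ weight t)%:R * T%:R <= (T ^ weight 1%g)%:R :> R.
    by rewrite -natrM ler_nat -expnSr leq_pexp2l // weight_lt.
  case: (odd_perm t); rewrite ?expr1 ?expr0 ?mulN1r ?mul1r ?mulNr ?lerN2 //.
  by apply: le_trans (_ : 0 <= _); rewrite ?oppr_le0 ?ltW // mulr_gt0 // ltr0n expn_gt0 T_gt0.
apply: lt_le_trans (lerD (lexx _) lb).
rewrite mulNrn subr_gt0 -[_ *+ #|_|]mulr_natr ltr_pM2l // ltr_nat.
by apply: leq_trans fact_le_T; rewrite card1.
Qed.

End Staircase.

(** * Positroids from increasing maximal minors *)

Section ColumnMatroid.
Local Open Scope ring_scope.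
Variables (R : realFieldType) (r m : nat) (A : 'M[R]_(r, m)).
Implicit Types (X Y : {set 'I_m}) (f : 'I_r -> 'I_m).

Definition cols (s : seq 'I_m) : seq 'cV[R]_r := [seq col j A | j <- s].

Lemma free_cols_perm (s t : seq 'I_m) : perm_eq s t -> free (cols s) = free (cols t).
Proof. by move=> st; apply: perm_free; apply: perm_map. Qed.

Lemma free_cols_det f : injective f ->
  free (cols (enum (f @: [set: 'I_r]))) = (\det (colsub f A) != 0).
Proof.
move=> injf; have pe : perm_eq (enum (f @: [set: 'I_r])) (codom f).
  apply: uniq_perm => [||x]; [exact: enum_uniq | exact/injectiveP |].
  rewrite mem_enum; apply/imsetP/codomP => [[i _ ->]|[i ->]]; first by exists i.
  by exists i.
rewrite (free_cols_perm pe).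
have -> : cols (codom f) = [tuple col (f i) A | i < r].
  by rewrite /cols /= /codom /image_mem -map_comp.
have sumE (c : 'rV[R]_r) : \sum_(i < r) c 0 i *: [tuple col (f i) A | i < r]`_i =
    colsub f A *m c^T.
  apply/colP => l; rewrite summxE mxE; apply: eq_bigr => i _.
  by rewrite -tnth_nth tnth_mktuple !mxE mulrC.
rewrite -unitfE -unitmxE; apply/freeP/idP => [h|u c].
  rewrite -unitmx_tr -row_free_unit; apply: inj_row_free => v v0.
  apply/rowP => i; rewrite mxE; apply: (h (fun i => v 0 i)).
  by rewrite sumE; apply: trmx_inj; rewrite trmx_mul trmxK v0 trmx0.
move=> c0 i; pose v : 'rV[R]_r := \row_i c i.
have : colsub f A *m v^T = 0.
  by rewrite -sumE -[RHS]c0; apply: eq_bigr => j _; rewrite mxE.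
move/(congr1 (mulmx (invmx (colsub f A)))); rewrite mulKmx // mulmx0.
by move/colP/(_ i); rewrite !mxE.
Qed.

Lemma enum_setU1 X x : x \notin X -> perm_eq (enum (x |: X)) (x :: enum X).
Proof.
move=> xX; apply: uniq_perm; rewrite /= ?enum_uniq ?mem_enum ?xX // => y.
by rewrite inE !mem_enum !inE.
Qed.

Lemma free_colsS X Y : X \subset Y -> free (cols (enum Y)) -> free (cols (enum X)).
Proof.
move=> XY; have pe : perm_eq (enum Y) (enum X ++ enum (Y :\: X)).
  apply: uniq_perm; rewrite ?cat_uniq ?enum_uniq //.
    by rewrite andbT; apply/hasPn => y; rewrite !mem_enum inE => /andP[].
  move=> y; rewrite mem_cat !mem_enum inE; have [/(subsetP XY)->//|_] := boolP (y \in X).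
  by [].
by rewrite (free_cols_perm pe) /cols map_cat => /catl_free.
Qed.

(** A maximal free set of columns containing [X] spans all columns, among which the nonzero minor
    supplies [r] independent ones. *)
Lemma free_cols_extend X f : \det (colsub f A) != 0 -> injective f ->
  free (cols (enum X)) ->
  exists Y, [/\ X \subset Y, #|Y| = r & free (cols (enum Y))].
Proof.
move=> df injf fX.
have [Y /maxsetP[fY maxY] XY] := maxset_exists (P := fun Y => free (cols (enum Y))) fX.
exists Y; split=> //.
have szY : size (cols (enum Y)) = #|Y| by rewrite size_map -cardE.
have spanY j : col j A \in <<cols (enum Y)>>%VS.
  have [jY|jY] := boolP (j \in Y); first by apply/memv_span/map_f; rewrite mem_enum.
  apply/negPn/negP => nj; case/negP: (jY).
  rewrite -(maxY (j |: Y)) ?subsetUr ?setU11 //.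
  by rewrite (free_cols_perm (enum_setU1 jY)) /= free_cons nj.
have ff : free (cols (enum (f @: [set: 'I_r]))) by rewrite free_cols_det.
have szf : size (cols (enum (f @: [set: 'I_r]))) = r.
  by rewrite size_map -cardE card_imset // cardsT card_ord.
apply/eqP; rewrite eqn_leq; apply/andP; split.
  move: fY; rewrite /free szY => /eqP <-.
  by apply: leq_trans (dimvS (subvf _)) _; rewrite dimvf /dim /= muln1.
move: ff fY; rewrite /free szf szY => /eqP df' /eqP <-.
rewrite -[X in (X <= _)%N]df'; apply: dimvS.
by apply/span_subvP => _ /mapP[j _ ->].
Qed.

End ColumnMatroid.

Lemma indep_extend (E : finType) (M : matroid E) (I : {set E}) :
  I \in indep M -> exists J : {set E}, [/\ I \subset J, J \in indep M & #|J| = mrank M].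
Proof.
move=> iI; have [|J mJ IJ] :=
  @maxset_exists _ (fun J : {set E} => (J \in indep M) && (J \subset [set: E])) I.
  by rewrite iI subsetT.
exists J; split=> //; first by case/maxsetP: mJ => /andP[].
exact: basis_card.
Qed.

(** Independent sets on both sides are the subsets of [r]-element ones, where freeness means a
    nonzero minor. Free sets of columns extend to size [r] because a basis of [M] gives one nonzero
    minor. *)
Lemma positroid_of_minors (R : realType) (m r : nat) (M : matroid 'I_m)
    (A : 'M[R]_(r, m)) : mrank M = r ->
  (forall f : 'I_r -> 'I_m, {homo f : i j / i < j} -> (0 <= \det (colsub f A))%R) ->
  (forall f : 'I_r -> 'I_m, {homo f : i j / i < j} ->
     (\det (colsub f A) != 0)%R = (f @: [set: 'I_r] \in indep M)) ->
  positroid R M.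
Proof.
move=> er; subst r => A_ge0 A_indep.
have indepE (Y : {set 'I_m}) : (Y \in indep M) = free (cols A (enum Y)).
  apply/idP/idP => [/indep_extend[Z [YZ iZ cZ]]|fY].
    have [f [hf ef]] := increasing_enum cZ.
    apply: free_colsS YZ _; rewrite -ef free_cols_det; last exact: increasing_inj.
    by rewrite A_indep // ef.
  have [Z [_ iZ cZ]] := indep_extend (indep0 M).
  have [f [hf ef]] := increasing_enum cZ.
  have df : (\det (colsub f A) != 0)%R by rewrite A_indep // ef.
  have [X [YX cX fX]] := free_cols_extend df (increasing_inj hf) fY.
  have [g [hg eg]] := increasing_enum cX.
  apply: indepS YX; rewrite -eg -A_indep // -free_cols_det ?eg //.
  exact: increasing_inj.
(* [positroid] indexes columns by ['I_#|'I_m|]; [c] identifies this with ['I_m] in the same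
   order. *)
pose c := cast_ord (card_ord m); have injc : injective c by exact: cast_ord_inj.
exists c, (colsub c A); split.
- by exists (cast_ord (esym (card_ord m))); [exact: cast_ordK | exact: cast_ordKV].
- move=> X; rewrite indepE.
  have pe : perm_eq (enum (c @: X)) [seq c j | j <- enum X].
    apply: uniq_perm; rewrite ?map_inj_uniq ?enum_uniq // => x; rewrite mem_enum.
    by apply/imsetP/mapP => -[j jX ->]; exists j; rewrite ?mem_enum // -mem_enum.
  rewrite (free_cols_perm A pe) /cols -map_comp; congr (free _).
  by apply: eq_map => j; apply/colP => i; rewrite !mxE.
- move=> f hf; have -> : colsub f (colsub c A) = colsub (c \o f) A.
    by apply/matrixP => i j; rewrite !mxE.
  by apply: A_ge0 => i j ij /=; exact: hf.
Qed.

(** * The interval matroids *)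

Definition itv (m l u : nat) : {set 'I_m} := [set x : 'I_m | l <= x < u].

Lemma card_itv m l u : u <= m -> #|itv m l u| = u - l.
Proof.
move=> um; have lt (i : 'I_(u - l)) : l + i < m by have := ltn_ord i; lia.
pose f i := Ordinal (lt i); have injf : injective f.
  by move=> i j [] /addnI /val_inj.
have -> : itv m l u = f @: [set: 'I_(u - l)].
  apply/setP => x; rewrite inE; apply/idP/imsetP => [h|[i _ ->] /=].
    have xl : x - l < u - l by lia.
    by exists (Ordinal xl) => //; apply: val_inj => /=; lia.
  by have := ltn_ord i; lia.
by rewrite card_imset // cardsT card_ord.
Qed.

Section IncreasingCount.
Variables (k m : nat) (g : 'I_k -> 'I_m).
Hypothesis g_incr : {homo g : i j / i < j}.
Let count c := #|[set i | g i < c]|.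

(** The indices with [g i < c] form an initial segment, since [g] is increasing. This turns
    cardinality bounds into inequalities on indices. *)
Lemma ltn_count c (i : 'I_k) : (i < count c) = (g i < c).
Proof.
have homo (j : 'I_k) : (j <= i -> g j <= g i) /\ (i <= j -> g i <= g j).
  by split; rewrite leq_eqVlt => /orP[/eqP/val_inj->//|/g_incr/ltnW].
apply/idP/idP => [|gi]; last first.
  rewrite -[i.+1]subn0 -(card_itv 0 (ltn_ord i)); apply: subset_leq_card.
  apply/subsetP => j; rewrite !inE /= ltnS => ji.
  by apply: leq_ltn_trans gi; case: (homo j) => h _; exact: h.
apply: contraTT; rewrite -!leqNgt => gi.
rewrite -[X in _ <= X]subn0 -(card_itv 0 (ltnW (ltn_ord i))); apply: subset_leq_card.
apply/subsetP => j; rewrite !inE /= => gj; rewrite ltnNge; apply/negP => ij.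
by case: (homo j) => _ /(_ ij); lia.
Qed.

Lemma card_codom_itv l u : #|g @: [set: 'I_k] :&: itv m l u| = count u - count l.
Proof.
have -> : g @: [set: 'I_k] :&: itv m l u = g @: itv k (count l) (count u).
  apply/setP => x; rewrite inE; apply/andP/imsetP => [[/imsetP[i _ ->]]|[i hi ->]].
    by rewrite inE => h; exists i; rewrite // inE ltn_count leqNgt ltn_count -leqNgt.
  split; first exact: imset_f.
  by move: hi; rewrite !inE ltn_count leqNgt ltn_count -leqNgt.
rewrite card_imset; last exact: increasing_inj.
by rewrite card_itv // -[X in _ <= X]card_ord max_card.
Qed.

End IncreasingCount.

Lemma card_preim_le (k m l u : nat) (f : 'I_k -> 'I_m) (S : {set 'I_k}) :
  injective f -> u <= m -> (forall i, i \in S -> l <= f i < u) -> #|S| <= u - l.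
Proof.
move=> injf um h; rewrite -(card_itv l um) -(card_imset _ injf).
by apply/subset_leq_card/subsetP => _ /imsetP[i iS ->]; rewrite inE h.
Qed.

Section RankOne.
Variables (E : finType) (D : {set E}).

Definition rank1_sets : {set {set E}} := [set J : {set E} | (#|J| <= 1) && (J \subset D)].

Lemma rank1_0 : set0 \in rank1_sets.
Proof. by rewrite inE cards0 sub0set. Qed.

Lemma rank1_S (I J : {set E}) : J \in rank1_sets -> I \subset J -> I \in rank1_sets.
Proof.
rewrite !inE => /andP[h JD] IJ.
by rewrite (leq_trans (subset_leq_card IJ)) //= (subset_trans IJ).
Qed.

Lemma rank1_aug (I J : {set E}) : I \in rank1_sets -> J \in rank1_sets -> #|I| < #|J| ->
  exists2 x, x \in J :\: I & x |: I \in rank1_sets.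
Proof.
move=> _ jJ lt; have : #|J| <= 1 by move: jJ; rewrite inE => /andP[].
move=> J1; have I0 : I = set0 by apply/eqP; rewrite -cards_eq0; lia.
have /card_gt0P[x xJ] : 0 < #|J| by lia.
by exists x; rewrite I0 ?setD0 // setU0 (rank1_S jJ) // sub1set.
Qed.

Definition rank1 : matroid E := Matroid rank1_0 rank1_S rank1_aug.

Lemma mrank_rank1 x : x \in D -> mrank rank1 = 1.
Proof.
move=> xD; apply/eqP; rewrite /mrank eqn_leq; apply/andP; split.
  by have [I [+ _ <-]] := rk_witness rank1 [set: E]; rewrite inE => /andP[].
rewrite -(cards1 x); apply: rk_indep; last exact: subsetT.
by rewrite inE cards1 sub1set.
Qed.

End RankOne.

Lemma card_bigcup_le (I E : finType) (P : pred I) (J : I -> {set E}) :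
  (forall i, #|J i| <= 1) -> #|\bigcup_(i | P i) J i| <= #|[set i | P i]|.
Proof.
move=> J1; rewrite -[X in _ <= X]sum1_card [X in _ <= X](eq_bigl P) => [|i]; last by rewrite inE.
elim/big_ind2: _ => [|S a T b hS hT|i _]; [by rewrite cards0 | | exact: J1].
by apply: leq_trans (leq_add hS hT); rewrite -cardsUI leq_addr.
Qed.

Section Intervals.
Variables (n p : nat).
Hypothesis p_ge : 4 * n <= p.
Notation m := (18 * n).
Notation A := (itv m 0 (7 * n)).
Notation B := (itv m p (p + 7 * n)).

Lemma itvAB : A :&: B = itv m p (7 * n).
Proof. by apply/setP => x; rewrite !inE; lia. Qed.

(** The overlap has size [7n - p], at most [3n] by [p_ge]. *)
Lemma itvAB_small : #|A :&: B| + 5 * n <= 4 * n + 4 * n.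
Proof. by rewrite itvAB card_itv; lia. Qed.

Definition itv_matroid : matroid 'I_m := two_bound itvAB_small.
Let M := itv_matroid.

Hypotheses (n_gt0 : 0 < n) (p_le : p <= 7 * n).

Lemma itv_sizes : [/\ 0 < 4 * n, 4 * n < 5 * n, #|A| = 7 * n, #|B| = 7 * n &
  #|~: A| = 11 * n /\ #|~: B| = 11 * n].
Proof.
have cA : #|A| = 7 * n by rewrite card_itv; lia.
have cB : #|B| = 7 * n by rewrite card_itv; lia.
have := cardsC A; have := cardsC B; rewrite card_ord => hB hA.
by split; lia.
Qed.

Lemma mrank_itv : mrank M = 5 * n.
Proof. by have [? ? ? ? [? ?]] := itv_sizes; apply: mrank_two_bound; lia. Qed.

Lemma itv_coloop_free : coloop_free M.
Proof. by have [? ? ? ? [? ?]] := itv_sizes; apply: two_bound_coloop_free; lia. Qed.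

Section Placement.
Variables (k : nat) (g : 'I_k -> 'I_m).
Hypothesis g_incr : {homo g : i j / i < j}.

(* The i-th element is placed in row q + i, where q = n - #{elements before B}
   is the least shift that moves the elements of B out of the first n rows. *)
Lemma itv_placement : g @: [set: 'I_k] \in indep M ->
  exists q, forall i : 'I_k, (g i < 7 * n -> q + i < 4 * n) /\
    (p <= g i < p + 7 * n -> n <= q + i < 5 * n).
Proof.
move=> /two_boundP[]; rewrite card_imset; last exact: increasing_inj.
rewrite cardsT card_ord !card_codom_itv //.
have := subset_leq_card (subsetIr (g @: [set: 'I_k]) (itv m p (7 * n))).
rewrite card_codom_itv // card_itv; last by lia.
have := ltn_count g_incr p; have := ltn_count g_incr (7 * n).
have := ltn_count g_incr (p + 7 * n).
have -> : #|[set i | g i < 0]| = 0 by apply/eqP; rewrite cards_eq0; apply/eqP/setP => i; rewrite !inE.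
set c1 := #|[set i | g i < p]|; set c2 := #|[set i | g i < 7 * n]|.
set c3 := #|[set i | g i < p + 7 * n]|.
(* If [c1 < n], the elements of [B] start at row [n]: at most [3n] of them lie in [A] and at most
   [4n] in all. If [n <= c1], then [q = 0], and the bounds [4n] on [A] and [5n] on the whole set
   suffice. *)
move=> h3 h2 h1 hAB hk hA hB; exists (n - c1) => i.
have := h1 i; have := h2 i; have := h3 i; have := ltn_ord i.
by move=> *; split; lia.
Qed.

End Placement.

(** A converse to [itv_placement]: distinct rows are used, and [A] and [B] each have only [4n] rows
    available. *)
Lemma itv_indep_of_rows (k r : nat) (g : 'I_k -> 'I_m) (f : 'I_k -> 'I_r) :
  injective g -> injective f -> k <= 5 * n -> 5 * n <= r ->
  (forall i, g i < 7 * n -> f i < 4 * n) ->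
  (forall i, p <= g i < p + 7 * n -> n <= f i < 5 * n) ->
  g @: [set: 'I_k] \in indep M.
Proof.
move=> injg injf kn nr hA hB; apply/two_boundP.
have preim (S : {set 'I_m}) : #|g @: [set: 'I_k] :&: S| = #|[set i | g i \in S]|.
  rewrite -(card_imset _ injg); apply: eq_card => x; rewrite inE.
  apply/andP/imsetP => [[/imsetP[i _ ->] h]|[i + ->]]; first by exists i; rewrite // inE.
  by rewrite inE imset_f.
split; first by rewrite card_imset // cardsT card_ord.
  rewrite preim -[4 * n]subn0; apply: (card_preim_le injf); first by lia.
  by move=> i; rewrite !inE /=; exact: hA.
rewrite preim (_ : 4 * n = 5 * n - n); last by lia.
by apply: (card_preim_le injf) => // i; rewrite !inE; exact: hB.
Qed.

Lemma itv_transversal : transversal_matroid M.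
Proof.
(* The transversal presentation: row [i] admits [A] if [i < 4n], [B] if [n <= i], and every element
   outside both. *)
pose D (i : 'I_(5 * n)) : {set 'I_m} :=
  [set x : 'I_m | ((x \in A) ==> (i < 4 * n)) && ((x \in B) ==> (n <= i))].
exists (5 * n), (fun i => rank1 (D i)); split.
  (* Element [14n] lies beyond [A] and [B], hence in every [D i]. *)
  move=> i; have lt : 14 * n < m by lia.
  by apply: (@mrank_rank1 _ _ (Ordinal lt)); rewrite !inE /=; lia.
move=> I; split=> [iI|[J iJ ->]].
  have [g [hg eg]] := increasing_enum (erefl #|I|).
  have kn : #|I| <= 5 * n by case/two_boundP: iI.
  rewrite -eg in iI; have [q hq] := itv_placement hg iI.
  (* Elements after [B] may be shifted past the last row; wrapping around keeps rows distinct as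
     [#|I| <= 5n], and does not move elements of [A] or [B]. *)
  have mod_lt j : j %% (5 * n) < 5 * n by rewrite ltn_mod; lia.
  pose row (i : 'I_#|I|) := Ordinal (mod_lt (q + i)).
  have row_inj : injective row.
    move=> i j [] /eqP; rewrite eqn_modDl => /eqP; rewrite !modn_small; last 2 first.
    - exact: leq_trans (ltn_ord _) kn.
    - exact: leq_trans (ltn_ord _) kn.
    exact: val_inj.
  exists (fun i => [set g j | j in [set j | row j == i]]) => [i|]; last first.
    rewrite -{1}eg; apply/setP => x; apply/imsetP/bigcupP => [[j _ ->]|[i _ /imsetP[j _ ->]]].
      by exists (row j) => //; rewrite imset_f // inE.
    by exists j.
  rewrite inE; apply/andP; split.
    rewrite card_imset; last exact: increasing_inj.
    apply/card_le1_eqP => j l; rewrite !inE => /eqP rj /eqP rl.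
    by apply: row_inj; rewrite rj rl.
  apply/subsetP => x /imsetP[j]; rewrite inE => /eqP <- ->.
  have [h1 h2] := hq j; rewrite !inE /=; apply/andP; split; apply/implyP => h.
    by rewrite modn_small ?h1 // (leq_trans (h1 h)) // leq_mul2r orbT.
  by have /andP[nq q5] := h2 h; rewrite modn_small.
have J1 i : #|J i| <= 1 by have := iJ i; rewrite inE => /andP[].
have JD i x : x \in J i -> x \in D i.
  by have := iJ i; rewrite inE => /andP[_ /subsetP h]; exact: h.
have bound (S : {set 'I_m}) l u : u <= 5 * n ->
    (forall i x, x \in J i -> x \in S -> l <= i < u) ->
    #|\bigcup_(i < 5 * n) J i :&: S| <= u - l.
  move=> un h; rewrite -(card_itv l un).
  apply: leq_trans (_ : #|\bigcup_(i | i \in itv (5 * n) l u) J i| <= _).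
    apply/subset_leq_card/subsetP => x /setIP[/bigcupP[i _ xi] xS].
    by apply/bigcupP; exists i; rewrite // inE (h i x).
  by apply: leq_trans (card_bigcup_le _ J1) _; apply/subset_leq_card/subsetP => i; rewrite inE.
apply/two_boundP; split.
- by have := bound [set: _] 0 _ (leqnn _) (fun i _ _ _ => ltn_ord i); rewrite setIT subn0.
- rewrite -[4 * n]subn0; apply: bound => [|i x /JD]; first by lia.
  by rewrite inE => /andP[/implyP h _] /h.
- rewrite (_ : 4 * n = 5 * n - n); last by lia.
  by apply: bound => [//|i x /JD]; rewrite inE => /andP[_ /implyP h] /h ->; exact: ltn_ord.
Qed.

(* The rows with index at least 5n give every element outside A and B a row of its
   own. Multiplying by a totally positive matrix with 5n rows then truncates
   to rank 5n. *)
Definition itv_support (i j : nat) : bool :=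
  [&& (j < 7 * n) ==> (i < 4 * n),
      (p <= j < p + 7 * n) ==> (n <= i < 5 * n) &
      (p + 7 * n <= j) ==> (i == 5 * n + j)].

(** Each column is supported on an interval of rows, and both ends of the interval are nondecreasing
    in [j]. *)
Lemma itv_support_stair i i' j j' : i < i' -> j < j' ->
  itv_support i j' -> itv_support i' j -> itv_support i j && itv_support i' j'.
Proof. by rewrite /itv_support; lia. Qed.

Variable R : realType.

(** The base is the number of permutations in a minor of size [5n], as [stair_det_gt0] requires; the
    exponents come from row and column indices. *)
Definition itv_stair : 'M[R]_(23 * n, m) :=
  \matrix_(i, j) (if itv_support i j then ((5 * n)`! ^ (i * j))%:R else 0)%R.

Section Minors.
Variables (f : 'I_(5 * n) -> 'I_(23 * n)) (g : 'I_(5 * n) -> 'I_m).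
Hypotheses (f_incr : {homo f : i j / i < j}) (g_incr : {homo g : i j / i < j}).

Let minorE : rowsub f (colsub g itv_stair) =
  stair_mx f g (fun i j => itv_support (f i) (g j)) R (5 * n)`!.
Proof. by apply/matrixP => i j; rewrite !mxE. Qed.

Let stairP (i i' j j' : 'I_(5 * n)) : i < i' -> j < j' ->
  itv_support (f i) (g j') -> itv_support (f i') (g j) ->
  itv_support (f i) (g j) && itv_support (f i') (g j').
Proof. by move=> ii jj; apply: itv_support_stair; [exact: f_incr | exact: g_incr]. Qed.

Lemma itv_minor_neq0 : (\det (rowsub f (colsub g itv_stair)) != 0)%R <->
  forall i, itv_support (f i) (g i).
Proof.
rewrite minorE; split=> [h|h]; first exact: (stair_det_neq0 f_incr g_incr stairP h).
by rewrite gt_eqF //; apply: stair_det_gt0.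
Qed.

Lemma itv_minor_ge0 : (0 <= \det (rowsub f (colsub g itv_stair)))%R.
Proof.
have [->//|/itv_minor_neq0 h] := eqVneq (\det (rowsub f (colsub g itv_stair)))%R 0%R.
by rewrite minorE ltW //; apply: stair_det_gt0.
Qed.

End Minors.

Lemma itv_positroid : positroid R M.
Proof.
pose P := Vandermonde (5 * n) (\row_(j < 23 * n) j%:R%R : 'rV[R]_(23 * n)).
apply: (@positroid_of_minors _ _ _ _ (P *m itv_stair)%R mrank_itv) => g hg; rewrite -mulmx_colsub.
  apply: det_mulmx_ge0 => f hf; [exact: Vandermonde_minor_gt0 | exact: itv_minor_ge0].
have nz := @det_mulmx_neq0 R _ _ P (colsub g itv_stair)
  (@Vandermonde_minor_gt0 R _ _) (fun f hf => itv_minor_ge0 hf hg).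
apply/idP/idP => [/nz[f hf /(itv_minor_neq0 hf hg) h]|iJ].
  apply: (@itv_indep_of_rows _ _ _ f) => //; try exact: increasing_inj.
  - by lia.
  - by move=> i; have := h i; rewrite /itv_support; lia.
  - by move=> i; have := h i; rewrite /itv_support; lia.
have [q hq] := itv_placement hg iJ; apply/nz.
(* Elements of [A :|: B] take their placed rows, later elements their private rows. *)
have lt (i : 'I_(5 * n)) : (if g i < p + 7 * n then q + i else 5 * n + g i) < 23 * n.
  by have := ltn_ord (g i); have := hq i; case: ifP; lia.
have hf : {homo (fun i => Ordinal (lt i)) : i j / i < j}.
  move=> i j ij /=; have := hg i j ij; have := hq i; have := hq j.
  by repeat case: ifP; lia.
exists (fun i => Ordinal (lt i)) => //; apply/itv_minor_neq0 => // i.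
by have := hq i; rewrite /itv_support /=; case: ifP; lia.
Qed.

End Intervals.

(** * Branch-width of the disjoint and of the overlapping pair *)

Lemma bw_disjoint n (n_gt0 : 0 < n) (h : 4 * n <= 7 * n) :
  bw (itv_matroid h) <= (4 * n).+1.
Proof.
have n7 : 0 < 7 * n by lia.
(* With [p = 7n], the quotient by [7n] is 0 on [A], 1 on [B] and 2 on the last [4n] elements. *)
apply: (@bw_spider (7 * n) _ _ _ (fun x : 'I_(18 * n) => x %/ (7 * n))
  (fun x : 'I_(18 * n) => x %% (7 * n))).
- by move=> x; rewrite ltn_divLR //; have := ltn_ord x; lia.
- by move=> x; rewrite ltn_mod.
- by move=> x y e1 e2; apply: val_inj; rewrite /= (divn_eq x (7 * n)) e1 e2 -divn_eq.
have arm c (x : 'I_(18 * n)) : x %/ (7 * n) == c -> c * (7 * n) <= x < c.+1 * (7 * n).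
  by move/eqP=> <-; rewrite -leq_divRL // leqnn -ltn_divLR //=.
case=> [|[|c]].
- apply: leq_trans (_ : rk (itv_matroid h) (itv _ 0 (7 * n)) <= _).
    by apply: rkS; apply/subsetP => x; rewrite !inE => /arm; lia.
  by rewrite rk_two_bound setDv cards0; lia.
- apply: leq_trans (_ : rk (itv_matroid h) (itv _ (7 * n) (7 * n + 7 * n)) <= _).
    by apply: rkS; apply/subsetP => x; rewrite !inE => /arm; lia.
  by rewrite rk_two_bound setDv cards0; lia.
- apply: leq_trans (rk_le_card _ _) _.
  have -> : 4 * n = #|itv (18 * n) (14 * n) (18 * n)| by rewrite card_itv; lia.
  apply/subset_leq_card/subsetP => x; rewrite !inE => /arm.
  by have := ltn_ord x; nia.
Qed.

Lemma bw_overlap n (n_gt0 : 0 < n) (h : 4 * n <= 4 * n) (h' : 4 * n <= 7 * n) :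
  5 * n < bw (itv_matroid h).
Proof.
rewrite /bw; case: ex_minnP => w /asboolP[D <-] _.
have [a0 ar cA cB [cA' cB']] := itv_sizes h n_gt0 h'.
have lt0 : 0 < 18 * n by lia.
have mr := mrank_itv h n_gt0 h'.
rewrite -[X in X < _]mr; apply: (bd_width_spanning D (Ordinal lt0)); rewrite ?mr.
- by lia.
- by move=> x; rewrite rk_two_boundT //; lia.
set A := itv _ 0 _ in cA cA'; set B := itv _ _ _ in cB cB'.
have cAB : #|~: (A :|: B)| = 7 * n.
  have := cardsC (A :|: B); rewrite card_ord.
  have -> : A :|: B = itv (18 * n) 0 (11 * n) by apply/setP => x; rewrite !inE; lia.
  by rewrite card_itv; lia.
have small (X : {set 'I_(18 * n)}) : rk (itv_matroid h) X < 5 * n ->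
    #|X| < 5 * n \/ #|X :\: A| < n \/ #|X :\: B| < n.
  by rewrite rk_two_bound -/A -/B; lia.
have incl (X : {set 'I_(18 * n)}) : [/\ #|X :\: A| <= #|X|, #|X :\: B| <= #|X|,
    #|X :\: (A :|: B)| <= #|X :\: A| & #|X :\: (A :|: B)| <= #|X :\: B|].
  split; apply: subset_leq_card; rewrite ?subsetDl // setDS ?subsetUl ?subsetUr //.
move=> X1 X2 X3 /small s1 /small s2 /small s3; apply/negP => /eqP e.
(* Counting outside [set0], [A], [B] or [A :|: B], according to the reasons why the three sets fail
   to span, gives a contradiction. The sharp cases are [11n = n + 5n + 5n] outside [A] or [B], and
   [7n = n + n + 5n] outside both. *)
have cov (S : {set 'I_(18 * n)}) : #|~: S| <= #|X1 :\: S| + #|X2 :\: S| + #|X3 :\: S|.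
  rewrite -setTD -e !setDUl; apply: leq_trans (leq_card_setU _ _).1 _.
  by rewrite leq_add2r (leq_card_setU _ _).1.
have := cov A; have := cov B; have := cov (A :|: B); have := cov set0.
rewrite !setD0 setC0 cardsT card_ord cA' cB' cAB.
have [? ? ? ?] := incl X1; have [? ? ? ?] := incl X2; have [? ? ? ?] := incl X3.
by lia.
Qed.

Theorem theorem6p2 (R : realType) (n : nat) (n_gt0 : 0 < n) :
  exists (S T : finType) (M : matroid S) (N : matroid T),
    [/\ coloop_free M /\ coloop_free N,
        positroid R M /\ positroid R N,
        transversal_matroid M /\ transversal_matroid N,
        same_configuration M N &
        bw M + n <= bw N].
Proof.
(* [h47] takes [p = 7n], the disjoint pair; [h44] takes [p = 4n], an overlap of [3n]. *)
have h47 : 4 * n <= 7 * n by lia.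
have h44 := leqnn (4 * n); have h77 := leqnn (7 * n).
have [a0 ar cA cB [cA' cB']] := itv_sizes h47 n_gt0 h77.
have [_ _ dA dB _] := itv_sizes h44 n_gt0 h47.
exists 'I_(18 * n), 'I_(18 * n), (itv_matroid h47), (itv_matroid h44); split.
- by split; apply: itv_coloop_free.
- by split; apply: itv_positroid.
- by split; apply: itv_transversal.
- by apply: two_bound_same_configuration; rewrite ?dA ?dB ?cA ?cB //; lia.
- by have := bw_disjoint n_gt0 h47; have := bw_overlap n_gt0 h44 h47; lia.
Qed.
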